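(* Let $d\geq 3$. There exists a constant $C=C(d)>0$ depending only on $d$ such that the following holds. Let $\Omega_\ast\subset\mathbb{R}^d$ be a sphere shell of outer radius $r$ and thickness $w$ ($0<w\le r$), and let $A_0A_1\cdots A_d$ be an arbitrary fixed simplex in $\mathbb{R}^d$. Then $$\int_{\Sigma(A_0A_1\cdots A_d)\cap\Omega_\ast^{d+1}}\frac{dX_0\,dX_1\cdots dX_d}{|X_0X_1\cdots X_d|}\leq C\, w^{d+1}r^{d^2-d-1},$$ where $\Sigma(A_0A_1\cdots A_d)\subset(\mathbb{R}^d)^{d+1}$ is the set of all $(X_0,X_1,\dots,X_d)$ such that the simplex $X_0X_1\cdots X_d$ is reciprocal to $A_0A_1\cdots A_d$.
   Context: A sphere shell of outer radius $r$ and thickness $w$ in $\mathbb{R}^d$ is a set of the form $\{x\in\mathbb{R}^d: r-w\leq|x-p|\leq r\}$ for some center $p\in\mathbb{R}^d$. For $d+1$ points in $\mathbb{R}^d$, $|X_0X_1\cdots X_d|$ denotes the $d$-dimensional volume of the simplex with these vertices. A simplex is understood to be non-degenerate (vertices affinely independent). Reciprocal simplexes: two simplexes $A_1A_2\cdots A_{d+1}$ and $A_{d+2}A_{d+3}\cdots A_{2d+2}$ in $\mathbb{R}^d$ are called reciprocal to each other if and only if $$|A_1\cdots A_{d+1}|\cdot|A_{d+2}\cdots A_{2d+2}|=\max|A_{j_1}\cdots A_{j_{d+1}}|\cdot|A_{j_{d+2}}\cdots A_{j_{2d+2}}|,$$ where the maximum is taken over all permutations $(j_1,\dots,j_{2d+2})$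 of $1,2,\dots,2d+2$ (volumes of degenerate configurations being $0$). *)

(* Defs.v *)
From HB Require Import structures.
From mathcomp Require Import all_boot all_order all_algebra.
From mathcomp Require Import perm.
From mathcomp Require Import all_classical all_reals all_analysis.
From mathcomp Require Import measurable_realfun.

Set Implicit Arguments.
Unset Strict Implicit.
Unset Printing Implicit Defensive.

Import Order.TTheory GRing.Theory Num.Theory.
Import numFieldNormedType.Exports.

Local Open Scope classical_set_scope.
Local Open Scope ring_scope.
Local Open Scope ereal_scope.

Section sigma_finite_of.
Context {disp : measure_display} {T : measurableType disp} {R : realType}.
Variable m : {measure set T -> \bar R}.
Hypothesis sf : sigma_finite setT m.

Definition sigma_finite_of of sigma_finite setT m : set T -> \bar R := m.

HB.instance Definition _ := Measure.copy (sigma_finite_of sf) m.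
HB.instance Definition _ :=
  Measure_isSigmaFinite.Build _ _ _ (sigma_finite_of sf) sf.

Lemma sigma_finite_measure_ex :
  exists nu : {sigma_finite_measure set T -> \bar R}, forall A, m A = nu A.
Proof. by exists (sigma_finite_of sf). Qed.

End sigma_finite_of.

Section power_measure.
Context {disp : measure_display} {T : measurableType disp} {R : realType}.
Variable mu : {sigma_finite_measure set T -> \bar R}.

(* The [n]-fold product measure of [mu], by integration over slices. *)
Fixpoint power_measure (n : nat) : set (n.-tuple T) -> \bar R :=
  match n with
  | 0 => fun A => \d_([tuple] : 0.-tuple T) A
  | m.+1 => fun A =>
      \int[mu]_x power_measure [set t : m.-tuple T | A [tuple of x :: t]]
  end.

Let consm (m : nat) (p : T * m.-tuple T) : m.+1.-tuple T :=
  [tuple of p.1 :: p.2].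

Let measurable_consm m : measurable_fun setT (@consm m).
Proof. exact: measurable_cons. Qed.

Let power_measureE n : exists nu : {sigma_finite_measure set (n.-tuple T) -> \bar R},
  forall A, power_measure A = nu A.
Proof.
elim: n => [|n [nu IH]].
  apply: (@sigma_finite_measure_ex _ (0.-tuple T) R \d_[tuple]).
  apply: fin_num_fun_sigma_finite; first by rewrite measure0.
  by move=> A mA; rewrite /= diracE.
pose Q : {measure set (n.+1.-tuple T) -> \bar R} :=
  pushforward (mu \x nu) (@consm n).
pose P := Q (@measurable_consm n).
have sf : sigma_finite setT P.
  have /sigma_finiteP[F [TF ndF Foo]] := sigma_finiteT mu.
  have /sigma_finiteP[G [TG ndG Goo]] := sigma_finiteT nu.
  pose g (t : n.+1.-tuple T) : T * n.-tuple T :=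
    (tnth t ord0, [tuple of behead t]).
  have mg : measurable_fun setT g.
    by apply/measurable_fun_pairP; split;
      [exact: measurable_tnth|exact: measurable_behead].
  exists (fun i => g @^-1` (F i `*` G i)).
    apply/seteqP; split => // t _.
    have [i _ Fi] : (\bigcup_i F i) (g t).1 by rewrite -TF.
    have [j _ Gj] : (\bigcup_i G i) (g t).2 by rewrite -TG.
    exists (maxn i j) => //; split.
    - by move: Fi; exact/subsetPset/ndF/leq_maxl.
    - by move: Gj; exact/subsetPset/ndG/leq_maxr.
  move=> i; have [mF Fi] := Foo i; have [mG Gi] := Goo i; split.
    by rewrite -[X in measurable X]setTI; apply: mg => //; exact: measurableX.
  rewrite /P /Q /= /pushforward -comp_preimage.
  have -> : g \o @consm n = id.
    by apply/funext => -[x t]; rewrite /g /consm /=; congr pair; exact: val_inj.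
  by rewrite preimage_id product_measure1E// lte_mul_pinfty// ge0_fin_numE.
have [nu' nu'E] := sigma_finite_measure_ex sf; exists nu' => A.
rewrite -nu'E /= /P /Q /pushforward /product_measure1.
apply: eq_integral => x _ /=; rewrite IH; congr (nu _).
by apply/seteqP; split => t; rewrite /xsection /= inE.
Qed.

Let pm0 n : @power_measure n set0 = 0.
Proof. by have [nu ->] := power_measureE n; exact: measure0. Qed.

Let pm_ge0 n A : 0 <= @power_measure n A.
Proof. by have [nu ->] := power_measureE n. Qed.

Let pm_sigma_additive n : semi_sigma_additive (@power_measure n).
Proof.
have [nu nuE] := power_measureE n.
have -> : @power_measure n = nu by apply/funext.
exact: measure_semi_sigma_additive.
Qed.

HB.instance Definition _ n := isMeasure.Build _ _ _ (@power_measure n)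
  (pm0 n) (@pm_ge0 n) (@pm_sigma_additive n).

Let pm_sigma_finite n : sigma_finite setT (@power_measure n).
Proof.
have [nu nuE] := power_measureE n.
have -> : @power_measure n = nu by apply/funext.
exact: sigma_finiteT.
Qed.

HB.instance Definition _ n := Measure_isSigmaFinite.Build _ _ _
  (@power_measure n) (@pm_sigma_finite n).

Lemma power_measure_box n (A : 'I_n -> set T) :
  (forall i, measurable (A i)) ->
  @power_measure n [set t | forall i, A i (tnth t i)] = \prod_(i < n) mu (A i).
Proof.
elim: n A => [|n IH] A mA.
  rewrite big_ord0 /= diracE mem_set//.
  by case.
rewrite big_ord_recl -(IH (fun i => A (lift ord0 i)))//=.
set B := [set t : n.-tuple T | forall i, A (lift ord0 i) (tnth t i)].
rewrite (eq_integral (fun x => (\1_(A ord0) x)%:E * power_measure B)).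
  rewrite ge0_integralZr ?integral_indic ?setIT//.
  exact/measurable_EFinP/measurable_indic.
move=> x _; rewrite indicE; have [xA|xA] := boolP (x \in A ord0).
  rewrite mul1e; congr (power_measure _); apply/seteqP; split => t /= tA i.
    by have := tA (lift ord0 i); rewrite tnthS.
  case: (unliftP ord0 i) => [j ->|->]; last exact: set_mem.
  by rewrite tnthS; exact: tA.
rewrite mul0e -[RHS](@pm0 n); congr (power_measure _).
apply/seteqP; split => t //= /(_ ord0); rewrite tnth0 => /mem_set.
by rewrite (negbTE xA).
Qed.

End power_measure.

(* R^d. The alias [measurableTypeR R] of [R], on which [lebesgue_measure] lives,
   carries the Borel sigma-algebra; [d]-tuples carry the product one. *)
Notation euclid R d := (d.-tuple (measurableTypeR R)).

Section euclidean_geometry.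
Context {R : realType}.
Local Open Scope ring_scope.

Definition coord {d : nat} (x : euclid R d) (k : 'I_d) : R := tnth x k.

Definition edist {d : nat} (x y : euclid R d) : R :=
  Num.sqrt (\sum_(k < d) (coord x k - coord y k) ^+ 2).

Definition sphere_shell {d : nat} (p : euclid R d) (r w : R) : set (euclid R d) :=
  [set x | r - w <= edist x p <= r].

Definition convex_hull {d n : nat} (X : n.-tuple (euclid R d)) :
    set (euclid R d) :=
  [set x | exists c : 'I_n -> R,
    [/\ forall i, 0 <= c i, \sum_(i < n) c i = 1 &
        forall k, coord x k = \sum_(i < n) c i * coord (tnth X i) k]].

Definition affinely_independent {d n : nat} (X : n.-tuple (euclid R d)) : Prop :=
  forall c : 'I_n -> R,
    \sum_(i < n) c i = 0 ->
    (forall k, \sum_(i < n) c i * coord (tnth X i) k = 0) ->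
    forall i, c i = 0.

(* The measure of a convex hull of finitely many points is finite, so that
   [fine] loses nothing here. *)
Definition simplex_volume {d : nat} (X : d.+1.-tuple (euclid R d)) : R :=
  fine (power_measure lebesgue_measure (convex_hull X)).

(* The first (resp. last) [d.+1] points of the family [P] rearranged by [s]. *)
Definition first_half {d : nat} (P : (d.+1 + d.+1).-tuple (euclid R d))
    (s : 'S_(d.+1 + d.+1)) : d.+1.-tuple (euclid R d) :=
  [tuple tnth P (s (lshift d.+1 i)) | i < d.+1].

Definition last_half {d : nat} (P : (d.+1 + d.+1).-tuple (euclid R d))
    (s : 'S_(d.+1 + d.+1)) : d.+1.-tuple (euclid R d) :=
  [tuple tnth P (s (rshift d.+1 i)) | i < d.+1].

(* The products of volumes are nonnegative, so that the default value [0] of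
   the iterated maximum is harmless. *)
Definition reciprocal {d : nat} (A B : d.+1.-tuple (euclid R d)) : Prop :=
  [/\ affinely_independent A, affinely_independent B &
      simplex_volume A * simplex_volume B =
      \big[Num.max/0]_(s : 'S_(d.+1 + d.+1))
        (simplex_volume (first_half [tuple of A ++ B] s) *
         simplex_volume (last_half [tuple of A ++ B] s))].

End euclidean_geometry.

(* Main.v *)
Require Import Defs.
From HB Require Import structures.
From mathcomp Require Import all_boot all_order all_algebra.
From mathcomp Require Import perm.
From mathcomp Require Import all_classical all_reals all_analysis.
From mathcomp Require Import measurable_realfun ring lra zify.

Set Implicit Arguments.
Unset Strict Implicit.
Unset Printing Implicit Defensive.

Import Order.TTheory GRing.Theory Num.Theory.
Import numFieldNormedType.Exports.

Local Open Scope classical_set_scope.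
Local Open Scope ring_scope.

(** Write [D X] for the determinant of the matrix whose rows are the vectors
    [(1, X_k)]; up to a constant it is the volume of the simplex [X].

    Reciprocity is only used for the exchanges of one vertex [X_j] with one
    vertex [A_i].  Writing [X(j <- y)] for [X] with its [j]-th vertex replaced
    by [y], it gives
      [|D (X(j <- A_i))| |D (A(i <- X_j))| <= |D X| |D A|].
    The numbers [D (A(i <- X_j)) / D A] are the barycentric coordinates of
    [X_j] with respect to [A]; they add up to [1], so one of them is at least
    [1 / (d + 1)].  Hence for every [j] there is an [i] such that
      [|D (X(j <- A_i))| <= (d + 1) |D X|]
    ([reciprocal_replace_le]).  Taking the geometric mean over [j],
      [|D X|^-1 <= (d + 1) prod_j |D (X(j <- A_(f j)))| ^ (-1 / (d + 1))]
    for some choice function [f], and [f] can be summed over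
    ([reciprocal_volume_le]).  What has been gained over the borderline
    function [|D X|^-1] is that a given variable [X_k] occurs in only [d] of
    the [d + 1] factors on the right, so that its total exponent is
    [d / (d + 1) < 1]; and the bound no longer depends on [A].

    The vertices are then integrated out one at a time, the last one first.
    As a function of [X_k], each factor with [j <> k] is the absolute value of
    an affine function, to the power [-1 / (d + 1)].  The basic estimate is
    [slab_integral]: for an affine function [l], an exponent [g < 1] and any
    coordinate direction [s],
      [int_shell |l| ^ (- g) <= C w r ^ (d - 2) r ^ (1 - g) |d_s l| ^ (- g)].
    It says that a slab of thickness [h] meets the shell in a set of volume
    at most a constant times [w r ^ (d - 2) h].  After a rotation the slab is
    orthogonal to the first axis and its sections are annuli in dimension
    [d - 1], whose volume is at most a constant times [r ^ (d - 3)] times the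
    difference [O(w r)] of the squared radii; this is where [d >= 3] enters.
    The partial derivative of the determinant in the direction [s] is the
    determinant with the row [(1, X_k)] replaced by the [s]-th direction
    vector, so integrating [X_k] out amounts to replacing one row in each
    factor ([stage_integral]).  When every row has been replaced, the [j]-th
    factor is the determinant of [(1, A_(f j))] and of the [d] direction
    vectors, that is [+- 1]; multiplying the constants of the [d + 1] stages
    yields [C w ^ (d + 1) r ^ ((d - 2) (d + 1) + 1)]
    ([iterated_integral]).

    Degenerate positions need no separate treatment because negative powers
    take the value [+oo] at [0].  The set of reciprocal simplexes need not be
    known to be measurable, because the integral of a nonnegative function is
    a supremum over the simple functions below it
    ([ge0_le_integral_setT]). *)

Local Notation coord := Defs.coord.

(** * Integration over powers of a measure *)

Section power_measure_theory.
Local Open Scope ereal_scope.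
Context {disp : measure_display} {T : measurableType disp} {R : realType}.
Variable mu : {sigma_finite_measure set T -> \bar R}.

Lemma power_measureS n (A : set (n.+1.-tuple T)) :
  power_measure mu A =
  (mu \x power_measure mu (n := n))
    [set p : T * n.-tuple T | A [tuple of p.1 :: p.2]].
Proof.
rewrite /= /product_measure1; apply: eq_integral => x _; congr (power_measure _ _).
by apply/seteqP; split => t; rewrite /xsection /= inE.
Qed.

Lemma measurable_fun_cons n :
  measurable_fun setT (fun p : T * n.-tuple T => [tuple of p.1 :: p.2]).
Proof. exact: measurable_cons. Qed.

Lemma ge0_integral_power_measureS n (f : n.+1.-tuple T -> \bar R) :
  measurable_fun [set: n.+1.-tuple T] f -> (forall t, 0 <= f t) ->
  \int[power_measure mu (n := n.+1)]_t f t =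
  \int[mu]_x \int[power_measure mu (n := n)]_t f [tuple of x :: t].
Proof.
move=> mf f0.
pose Q : {measure set (n.+1.-tuple T) -> \bar R} :=
  pushforward (mu \x power_measure mu (n := n))
    (fun p : T * n.-tuple T => [tuple of p.1 :: p.2]).
rewrite (eq_measure_integral (Q (@measurable_fun_cons n))); last first.
  by move=> A mA _; exact: power_measureS.
rewrite ge0_integral_pushforward//; last exact: measurable_fun_cons.
rewrite preimage_setT fubini_tonelli1//.
- exact: measurableT_comp mf (@measurable_fun_cons n).
- by move=> x; exact: f0.
Qed.

Lemma measurable_fun_integral_cons n (f : n.+1.-tuple T -> \bar R) :
  measurable_fun [set: n.+1.-tuple T] f -> (forall t, 0 <= f t) ->
  measurable_fun setT
    (fun x => \int[power_measure mu (n := n)]_t f [tuple of x :: t]).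
Proof.
move=> mf f0.
apply: (measurable_fun_fubini_tonelli_F (m2 := power_measure mu (n := n))
  (fun p : T * n.-tuple T => f [tuple of p.1 :: p.2])) => //.
exact: measurableT_comp mf (@measurable_fun_cons n).
Qed.

Lemma measurable_slice n (A : set (n.+1.-tuple T)) y : measurable A ->
  measurable [set t : n.-tuple T | A [tuple of y :: t]].
Proof.
move=> mA; rewrite -[X in measurable X]setTI.
exact: (measurable_cons (f := fun=> y) (g := fun t : n.-tuple T => t)).
Qed.

Lemma measurable_fun_slice n (A : set (n.+1.-tuple T)) : measurable A ->
  measurable_fun setT
    (fun y => power_measure mu [set t : n.-tuple T | A [tuple of y :: t]]).
Proof.
move=> mA; pose B := (fun p : T * n.-tuple T => [tuple of p.1 :: p.2]) @^-1` A.
have mB : measurable B by rewrite -[B]setTI; exact: measurable_fun_cons.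
have := measurable_fun_xsection (power_measure mu (n := n)) mB.
congr (measurable_fun _ _); apply/funext => y /=; congr (power_measure _ _).
by apply/seteqP; split => t; rewrite /xsection /= inE.
Qed.

Lemma measurable_box n (A : 'I_n -> set T) : (forall i, measurable (A i)) ->
  measurable [set t : n.-tuple T | forall i, A i (tnth t i)].
Proof.
move=> mA; rewrite [X in measurable X](_ : _ =
    \bigcap_(i in setT) ((fun t : n.-tuple T => tnth t i) @^-1` A i)); last first.
  by apply/seteqP; split => t /= H i; [move=> _; exact: H|exact: (H i I)].
apply: fin_bigcap_measurable => // i _.
by rewrite -[X in measurable X]setTI; apply: measurable_tnth.
Qed.

(** Two measures that agree on boxes are equal: boxes form a pi-system that
    generates the product sigma-algebra, and the powers of an exhaustion by
    sets of finite measure exhaust the power. *)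
Lemma power_measure_unique n (m : {measure set (n.-tuple T) -> \bar R}) :
  (forall A : 'I_n -> set T, (forall i, measurable (A i)) ->
    m [set t | forall i, A i (tnth t i)] = \prod_(i < n) mu (A i)) ->
  forall X, measurable X -> power_measure mu X = m X.
Proof.
move=> mE; have /sigma_finiteP[F [TF ndF Foo]] := sigma_finiteT mu.
pose G : set (set (n.-tuple T)) := [set X | exists2 A : 'I_n -> set T,
  (forall i, measurable (A i)) & X = [set t | forall i, A i (tnth t i)]].
apply: (measure_unique G
  (fun k => [set t : n.-tuple T | forall i, F k (tnth t i)])).
- apply/seteqP; split.
    apply: smallest_sub; first exact: smallest_sigma_algebra.
    elim/big_ind : _ => //; first by move=> A B sA sB X [/sA|/sB].
    move=> i _ _ [A mA <-]; apply: sub_sigma_algebra.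
    exists (fun j => if j == i then A else setT).
      by move=> j; case: ifP.
    rewrite setTI; apply/seteqP; split => t /=.
      by move=> At j; case: eqP => [->|].
    by move/(_ i); rewrite eqxx.
  apply: smallest_sub; first exact: sigma_algebra_measurable.
  by move=> _ [A mA ->]; exact: measurable_box.
- move=> _ _ [A mA ->] [B mB ->]; exists (fun i => A i `&` B i).
    by move=> i; exact: measurableI.
  apply/seteqP; split => t /=; first by move=> [HA HB] i.
  by move=> H; split => i; have [] := H i.
- by move=> k; exists (fun=> F k) => // _; exact: (Foo k).1.
- apply/seteqP; split => // t _ /=.
  have /choice[k kP] : forall i, exists k, F k (tnth t i).
    move=> i; have : [set: T] (tnth t i) by [].
    by rewrite TF => -[k _ ?]; exists k.
  exists (\max_i k i)%N => // i.
  have /ndF/subsetPset : (k i <= \max_i k i)%N by exact: leq_bigmax.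
  by apply; exact: kP.
- by move=> _ [A mA ->]; rewrite mE// -power_measure_box.
- move=> k.
  rewrite [ltLHS](_ : _ = \prod_(i < n) mu (F k)); last first.
    by apply: power_measure_box => i; exact: (Foo k).1.
  suff : \prod_(i < n) mu (F k) \is a fin_num by rewrite ltey_eq => ->.
  apply: prode_fin_num => i _.
  by rewrite ge0_fin_numE//; exact: (Foo k).2.
Qed.

(** A permutation of the factors maps boxes to boxes and permutes the side
    lengths, so uniqueness applies. *)
Lemma power_measure_perm n (s : 'S_n) (A : set (n.-tuple T)) : measurable A ->
  power_measure mu [set t | A [tuple tnth t (s i) | i < n]] = power_measure mu A.
Proof.
move=> mA; pose f (t : n.-tuple T) := [tuple tnth t (s i) | i < n].
have mf : measurable_fun setT f.
  apply/measurable_fun_tnthP => i.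
  rewrite (_ : _ \o _ = fun t : n.-tuple T => tnth t (s i)).
    exact: measurable_tnth.
  by apply/funext => t /=; rewrite tnth_mktuple.
pose Q : {measure set (n.-tuple T) -> \bar R} :=
  pushforward (power_measure mu (n := n)) f.
rewrite [RHS](power_measure_unique (m := Q mf))// => B mB.
rewrite (reindex_inj (@perm_inj _ s^-1%g))/= -power_measure_box//.
congr (power_measure _ _); apply/seteqP; split => t /= Bt i.
  by have := Bt (s^-1%g i); rewrite tnth_mktuple permKV.
by have := Bt (s i); rewrite tnth_mktuple permK.
Qed.

End power_measure_theory.

(** * Affine substitutions on the line *)

Section change_of_variables_measure.
Local Open Scope ereal_scope.
Context d1 d2 (X : measurableType d1) (Y : measurableType d2) (R : realType).

(** The substitution rule for any map that scales measures by a constant;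
    all the changes of variables below are instances of it. *)
Lemma ge0_integral_scaled_pushforward (m1 : {measure set X -> \bar R})
    (m2 : {measure set Y -> \bar R}) (phi : X -> Y) (k : R) :
  (0 <= k)%R -> measurable_fun setT phi ->
  (forall A, measurable A -> k%:E * m1 (phi @^-1` A) = m2 A) ->
  forall f : Y -> \bar R, measurable_fun setT f -> (forall y, 0 <= f y) ->
  k%:E * \int[m1]_x f (phi x) = \int[m2]_y f y.
Proof.
move=> k0 mphi km f mf f0.
pose Q : {measure set Y -> \bar R} := pushforward m1 phi.
rewrite [RHS](eq_measure_integral (mscale (NngNum k0) (Q mphi))); last first.
  by move=> A mA _; rewrite -km.
rewrite ge0_integral_mscale//; congr (_ * _).
rewrite [RHS](@ge0_integral_pushforward _ _ _ _ _ phi mphi m1)//.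
Qed.

End change_of_variables_measure.

Section lebesgue_affine.
Local Open Scope ereal_scope.
Context {R : realType}.

Definition affine1 (a b : R) : measurableTypeR R -> measurableTypeR R :=
  fun x => (a * x + b)%R.

Lemma measurable_affine1 (a b : R) : measurable_fun setT (affine1 a b).
Proof. by apply: measurable_funD => //; exact: mulrl_measurable. Qed.

Lemma lebesgue_measure_affine1 (a b : R) (A : set (measurableTypeR R)) :
  a != 0%R -> measurable A ->
  `|a|%:E * lebesgue_measure (affine1 a b @^-1` A) = lebesgue_measure A.
Proof.
move=> a0 mA.
pose Q : {measure set (measurableTypeR R) -> \bar R} :=
  pushforward lebesgue_measure (affine1 a b).
have a_ge0 : (0 <= `|a|)%R by [].
symmetry.
apply: (@lebesgue_measure_unique R
  (mscale (NngNum a_ge0) (Q (measurable_affine1 a b)))) => //.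
move=> _ [[u v] _ <-]; rewrite /= /mscale /= /Q /pushforward /affine1 /=.
have [ap|an] := ltP 0%R a.
  rewrite (_ : _ @^-1` _ = `](u - b) / a, (v - b) / a]%classic)%R; last first.
    apply/seteqP; split => x /=; rewrite !in_itv/= ltr_pdivrMr// ler_pdivlMr//;
      by rewrite ltrBlDr lerBrDr mulrC.
  rewrite !lebesgue_measure_itv/= !lte_fin ltr_pM2r ?invr_gt0// ltrD2r.
  case: ifP => _; last by rewrite mule0.
  rewrite -!EFinD -EFinM gtr0_norm//; congr EFin; by field.
have {}an : (a < 0)%R by rewrite lt_neqAle a0 an.
rewrite (_ : _ @^-1` _ = `[(v - b) / a, (u - b) / a[%classic)%R; last first.
  apply/seteqP; split => x /=; rewrite !in_itv/= ltr_ndivlMr// ler_ndivrMr//;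
    by rewrite ltrBlDr lerBrDr mulrC andbC.
rewrite !lebesgue_measure_itv/= !lte_fin ltr_nM2r ?invr_lt0// ltrD2r.
case: ifP => _; last by rewrite mule0.
rewrite -!EFinD -EFinM ltr0_norm//; congr EFin; by field.
Qed.
End lebesgue_affine.

(** * Linear changes of variables *)

Section linear_change_of_variables.
Context {R : realType}.

Local Notation leb n := (power_measure (@lebesgue_measure R) (n := n)).

Definition affmap n (L : 'M[R]_n) (v : 'I_n -> R) (t : euclid R n) : euclid R n :=
  [tuple (\sum_j L i j * coord t j + v i : measurableTypeR R) | i < n].

Lemma coord_affmap n (L : 'M[R]_n) v t i :
  coord (affmap L v t) i = \sum_j L i j * coord t j + v i.
Proof. by rewrite /coord tnth_mktuple. Qed.

Lemma euclidP n (x y : euclid R n) : coord x =1 coord y -> x = y.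
Proof. exact: eq_from_tnth. Qed.

Lemma measurable_coord n (i : 'I_n) :
  measurable_fun setT (fun t : euclid R n => coord t i : measurableTypeR R).
Proof. exact: measurable_tnth. Qed.

Lemma measurable_affine n (c : 'I_n -> R) (b : R) :
  measurable_fun [set: euclid R n]
    (fun t => \sum_j c j * coord t j + b : measurableTypeR R).
Proof.
apply: measurable_funD => //; apply: measurable_sum => j.
by apply: measurable_funM => //; exact: measurable_coord.
Qed.

Lemma measurable_affmap n (L : 'M[R]_n) v : measurable_fun setT (affmap L v).
Proof.
apply/measurable_fun_tnthP => i.
rewrite (_ : _ \o _ = fun t => \sum_j L i j * coord t j + v i).
  exact: measurable_affine.
by apply/funext => t /=; rewrite tnth_mktuple.
Qed.

Lemma affmap_comp n (L M : 'M[R]_n) v :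
  affmap L v \o affmap M (fun=> 0) = affmap (L *m M) v.
Proof.
apply/funext => t; apply: euclidP => i /=; rewrite !coord_affmap; congr (_ + _).
under eq_bigr => j _ do rewrite coord_affmap addr0 mulr_sumr.
rewrite exchange_big/=; apply: eq_bigr => k _.
by rewrite mxE mulr_suml; apply: eq_bigr => j _; rewrite mulrA.
Qed.

(** For a lower triangular matrix the first coordinate of the image only
    depends on the first coordinate, and for a fixed first coordinate the other
    ones undergo an affine triangular map of one dimension less.  The
    translation part is part of the statement because it depends on the
    first coordinate in the inductive step. *)
Lemma power_measure_affmap_trig n (L : 'M[R]_n) v (A : set (euclid R n)) :
  is_trig_mx L -> (forall i, L i i != 0) -> measurable A ->
  ((`|\det L|)%:E * leb n (affmap L v @^-1` A) = leb n A)%E.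
Proof.
elim: n L v A => [|n IH] L v A trL L0 mA.
  rewrite det_mx00 normr1 mul1e; congr (leb _ _).
  by apply/seteqP; split => t; rewrite /= [affmap _ _ _]tuple0 [t]tuple0.
pose L' := \matrix_(i, j) L (lift ord0 i) (lift ord0 j).
pose w x i := L (lift ord0 i) ord0 * x + v (lift ord0 i).
pose a := L ord0 ord0; pose b := v ord0.
pose s y := [set t : euclid R n | A [tuple of y :: t]].
have affE (x : R) (t : euclid R n) :
    affmap L v [tuple of (x : measurableTypeR R) :: t] =
    [tuple of (affine1 a b x) :: affmap L' (w x) t].
  apply: euclidP => i; rewrite coord_affmap big_ord_recl /=.
  rewrite {1}/coord tnth0; case: (unliftP ord0 i) => [j|] ->.
    rewrite /coord tnthS tnth_mktuple /w addrCA addrA; congr (_ + _).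
    by congr (_ + _); apply: eq_bigr => k _; rewrite /coord tnthS mxE.
  rewrite big1 ?addr0 => [|k _]; first by rewrite /coord tnth0.
  by rewrite (is_trig_mxP trL)// mul0r.
have trL' : is_trig_mx L'.
  by apply/is_trig_mxP => i j ij; rewrite mxE (is_trig_mxP trL).
have detE : \det L = a * \det L'.
  rewrite !det_trig// big_ord_recl; congr (_ * _).
  by apply: eq_bigr => i _; rewrite mxE.
pose phi y := leb n (s y).
have IHE x : ((`|\det L'|)%:E * leb n [set t : euclid R n |
    A (affmap L v [tuple of (x : measurableTypeR R) :: t])] =
    phi (affine1 a b x))%E.
  rewrite /phi -(IH L' (w x) (s (affine1 a b x)) trL').
  - congr (_ * _)%E; congr (power_measure _ _).
    by apply/seteqP; split => t /=; rewrite affE.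
  - by move=> i; rewrite mxE.
  - exact: measurable_slice.
have a0 : a != 0 by exact: L0.
have maff : measurable_fun setT (affmap L v) := measurable_affmap L v.
rewrite detE normrM EFinM -muleA.
rewrite -[RHS](ge0_integral_scaled_pushforward (m1 := lebesgue_measure)
  (phi := affine1 a b) (k := `|a|) _ _ _ (f := phi))//.
- congr (_ * _)%E; rewrite /= -ge0_integralZl//.
  + by apply: eq_integral => x _; exact: IHE.
  + have mA' : measurable (affmap L v @^-1` A).
      by rewrite -[X in measurable X]setTI; exact: maff.
    exact: (measurable_fun_slice _ mA').
- exact: measurable_affine1.
- by move=> B mB; exact: lebesgue_measure_affine1.
- exact: measurable_fun_slice.
Qed.

Lemma power_measure_affmap_comp n (L M : 'M[R]_n) v (A : set (euclid R n)) :
  (forall B, measurable B ->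
    (`|\det L|)%:E * leb n (affmap L v @^-1` B) = leb n B)%E ->
  (forall B, measurable B ->
    (`|\det M|)%:E * leb n (affmap M (fun=> 0%R) @^-1` B) = leb n B)%E ->
  measurable A ->
  ((`|\det (L *m M)|)%:E * leb n (affmap (L *m M) v @^-1` A) = leb n A)%E.
Proof.
move=> HL HM mA; rewrite -affmap_comp comp_preimage det_mulmx normrM EFinM.
rewrite -muleA HM ?HL// -[X in measurable X]setTI.
exact: measurable_affmap.
Qed.

Lemma power_measure_affmap_perm n (s : 'S_n) (A : set (euclid R n)) :
  measurable A -> ((`|\det (perm_mx s : 'M[R]_n)|)%:E *
    leb n (affmap (perm_mx s) (fun=> 0%R) @^-1` A) = leb n A)%E.
Proof.
move=> mA; rewrite det_perm normrX normrN1 expr1n mul1e.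
rewrite -[RHS](power_measure_perm _ s)//; congr (power_measure _ _).
suff E t : affmap (perm_mx s) (fun=> 0) t = [tuple tnth t (s i) | i < n].
  by apply/seteqP; split => t /=; rewrite E.
apply: euclidP => i; rewrite coord_affmap addr0 /coord tnth_mktuple.
rewrite (bigD1 (s i))//= !mxE eqxx mul1r big1 ?addr0// => j jsi.
by rewrite !mxE eq_sym (negbTE jsi) mul0r.
Qed.

(** By the LUP decomposition an invertible matrix is a product of permutation
    matrices, a lower triangular matrix and an upper triangular one, which
    becomes lower triangular when the coordinates are listed backwards. *)
Lemma power_measure_affmap0 n (L : 'M[R]_n) (A : set (euclid R n)) :
  L \in unitmx -> measurable A ->
  ((`|\det L|)%:E * leb n (affmap L (fun=> 0%R) @^-1` A) = leb n A)%E.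
Proof.
case: n => [|n] in L A *.
  by move=> _ mA; apply: power_measure_affmap_trig => //; [apply/is_trig_mxP|]; case.
move=> uL; have := cormen_lup_correct L; have := cormen_lup_perm L.
have := cormen_lup_detL L; have := @cormen_lup_lower _ _ L.
have := @cormen_lup_upper _ _ L.
case: (cormen_lup L) => [[P D] U] /= upU lowD detD /is_perm_mxP[s ->] PLE.
pose r : 'S_n.+1 := perm (@rev_ord_inj n.+1).
pose J : 'M[R]_n.+1 := perm_mx r.
have rr : (r * r = 1)%g by apply/permP => i; rewrite permM !permE rev_ordK.
have JJ : J *m J = 1%:M by rewrite -perm_mxM rr perm_mx1.
(* Conjugating by the reversal [J] of the coordinates turns the upper
   triangular factor into a lower triangular one. *)
pose V := J *m U *m J.
have VE i j : V i j = U (rev_ord i) (rev_ord j).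
  have rV : (r^-1 = r)%g by rewrite -[RHS]mulg1 -(mulgV r) mulgA rr mul1g.
  by rewrite /V -row_permE -[X in _ *m perm_mx X]rV -col_permE !mxE !permE.
have LE : L = perm_mx s^-1 *m (D *m (J *m (V *m J))).
  have -> : J *m (V *m J) = U by rewrite /V -!mulmxA JJ mulmx1 mulmxA JJ mul1mx.
  rewrite -[D *m U]PLE mulmxA; change (L = perm_mx s^-1 *m perm_mx s *m L).
  by rewrite -perm_mxM mulVg perm_mx1 mul1mx.
have uU : \det U != 0.
  move: uL; rewrite unitmxE unitfE LE => H; apply: contra H => /eqP U0.
  by rewrite !det_mulmx U0 !(mulr0, mul0r).
have trV : is_trig_mx V.
  apply/is_trig_mxP => i j ij; rewrite VE upU//=.
  by move: ij (ltn_ord j) => /=; lia.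
have V0 i : V i i != 0.
  have : \det V != 0.
    have J0 : \det J != 0 by rewrite det_perm signr_eq0.
    by rewrite !det_mulmx !mulf_neq0.
  by rewrite det_trig// => /prodf_neq0; apply.
move=> mA; rewrite LE.
have [HJ HV] : (forall B, measurable B ->
    (`|\det J|)%:E * leb n.+1 (affmap J (fun=> 0%R) @^-1` B) = leb n.+1 B)%E /\
    (forall B, measurable B ->
    (`|\det V|)%:E * leb n.+1 (affmap V (fun=> 0%R) @^-1` B) = leb n.+1 B)%E.
  by split => B; [exact: power_measure_affmap_perm|exact: power_measure_affmap_trig].
apply: power_measure_affmap_comp => // B mB; first exact: power_measure_affmap_perm.
apply: power_measure_affmap_comp => // {mB}B mB.
  apply: power_measure_affmap_trig => // [|i].
    by apply/is_trig_mxP => i j ij; rewrite lowD ?(ltnW ij)// -val_eqE ltn_eqF.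
  by rewrite lowD ?eqxx ?oner_eq0.
apply: power_measure_affmap_comp => // {mB}B mB.
by apply: power_measure_affmap_comp.
Qed.

Lemma power_measure_affmap n (L : 'M[R]_n) v (A : set (euclid R n)) :
  L \in unitmx -> measurable A ->
  ((`|\det L|)%:E * leb n (affmap L v @^-1` A) = leb n A)%E.
Proof.
move=> uL mA; rewrite -(mul1mx L).
apply: power_measure_affmap_comp => // B mB; last exact: power_measure_affmap0.
apply: power_measure_affmap_trig => // i.
by rewrite mxE eqxx oner_eq0.
Qed.

End linear_change_of_variables.

(** * The volume of a simplex *)

Section simplex.
Context {R : realType}.

Local Notation leb n := (power_measure (@lebesgue_measure R) (n := n)).

(** The homogeneous coordinates [(1, x)].  Affine functions of [x] are linear
    in them, so that exchanging vertices of simplexes is exchanging rows of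
    matrices. *)
Definition homog d (x : euclid R d) (i : 'I_d.+1) : R :=
  if unlift ord0 i is Some k then coord x k else 1.

Lemma homog0 d (x : euclid R d) : homog x ord0 = 1.
Proof. by rewrite /homog unlift_none. Qed.

Lemma homogS d (x : euclid R d) k : homog x (lift ord0 k) = coord x k.
Proof. by rewrite /homog liftK. Qed.

Definition simplex_mx d (X : d.+1.-tuple (euclid R d)) : 'M[R]_d.+1 :=
  \matrix_(i, j) homog (tnth X i) j.

Definition edge_mx d (X : d.+1.-tuple (euclid R d)) : 'M[R]_d :=
  \matrix_(j, k) (coord (tnth X (lift ord0 k)) j - coord (tnth X ord0) j).

(** Subtracting the first row from all the others leaves the edge vectors. *)
Lemma det_simplex_mx d (X : d.+1.-tuple (euclid R d)) :
  \det (simplex_mx X) = \det (edge_mx X).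
Proof.
pose x0 := \row_j coord (tnth X ord0) j.
have -> : simplex_mx X = (block_mx (1%:M : 'M[R]_1) 0 (const_mx 1) 1%:M *m
    block_mx 1%:M x0 0 (trmx (edge_mx X)) : 'M[R]_(1 + d)).
  rewrite mulmx_block !mul1mx !mul0mx !mulmx1 !addr0.
  apply/matrixP => i j; rewrite !mxE split1.
  case: unliftP => [i' ->|->]; rewrite /= mxE split1;
    case: unliftP => [j' ->|->] /=.
  - by rewrite homogS !mxE big_ord1 !mxE mul1r addrC subrK.
  - by rewrite homog0 mxE.
  - by rewrite homogS mxE.
  - by rewrite homog0 mxE eqxx.
by rewrite det_mulmx (@det_lblock _ 1 d) (@det_ublock _ 1 d) !det1 det_tr !mul1r.
Qed.

Definition std_simplex d : set (euclid R d) :=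
  [set y | (forall k, 0 <= coord y k) /\ \sum_k coord y k <= 1].

Arguments std_simplex d : clear implicits.

Lemma measurable_std_simplex d : measurable (std_simplex d).
Proof.
rewrite [X in measurable X](_ : _ =
  [set y | forall k, [set z : measurableTypeR R | 0 <= z] (tnth y k)] `&`
  (fun y : euclid R d => \sum_k 1 * coord y k + 0 : measurableTypeR R) @^-1`
    `]-oo, 1]%classic).
  apply: measurableI.
    apply: (measurable_box (A := fun=> [set z : measurableTypeR R | 0 <= z])) => i.
    rewrite (_ : [set _ | _] = `[0, +oo[%classic)//.
    by apply/seteqP; split => z /=; rewrite in_itv/= andbT.
  rewrite -[X in measurable X]setTI; apply: measurable_affine => //.
apply/seteqP; split => y /=; rewrite in_itv/= addr0;
  by under eq_bigr do rewrite mul1r.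
Qed.

(** Only the positivity and finiteness of this volume matter: the standard
    simplex lies between two cubes. *)
Lemma std_simplex_volume d : exists2 k : R, 0 < k & leb d (std_simplex d) = k%:E.
Proof.
pose I (a : R) : set (measurableTypeR R) := `[0, a]%classic.
have IP (a z : R) : I a z = (0 <= z <= a) :> Prop by rewrite /I /= in_itv.
have leb_box (a : R) : 0 <= a ->
    leb d [set y | forall k, I a (tnth y k)] = (a ^+ d)%:E.
  move=> a0; transitivity (\prod_(i < d) lebesgue_measure (I a))%E.
    apply: (@power_measure_box _ _ R (@lebesgue_measure R) d (fun=> I a)) => i.
    exact: measurable_itv.
  have -> : lebesgue_measure (I a) = a%:E.
    rewrite lebesgue_measure_itv/= lte_fin.
    case: ltP => [_|a0']; first by rewrite sube0.
    by apply/eqP; rewrite eqe eq_le a0 a0'.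
  by rewrite prodEFin prodr_const card_ord.
have mbox (a : R) : measurable [set y : euclid R d | forall k, I a (tnth y k)].
  by apply: (measurable_box (A := fun=> I a)) => _; exact: measurable_itv.
have lo : (((d.+1%:R^-1) ^+ d)%:E <= leb d (std_simplex d))%E.
  rewrite -leb_box//; apply: le_measure; rewrite ?inE//.
    exact: measurable_std_simplex.
  move=> y /= yP; split => [k|]; first by have := yP k; rewrite IP => /andP[].
  apply: (@le_trans _ _ (\sum_(k < d) d.+1%:R^-1)).
    by apply: ler_sum => k _; have := yP k; rewrite IP => /andP[].
  rewrite sumr_const card_ord -[X in X <= _]mulr_natl ler_pdivrMr ?ltr0n//.
  by rewrite mul1r ler_nat leqnSn.
have hi : (leb d (std_simplex d) <= 1)%E.
  rewrite -[leRHS]/((1 : R)%:E) -(expr1n _ d) -leb_box//.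
  apply: le_measure; rewrite ?inE//; first exact: measurable_std_simplex.
  move=> y [y0 y1] k /=; rewrite IP y0/= (le_trans _ y1)//.
  by rewrite (bigD1 k)//= lerDl sumr_ge0.
exists (fine (leb d (std_simplex d))).
  rewrite fine_gt0// (lt_le_trans _ lo) ?lte_fin ?exprn_gt0 ?invr_gt0 ?ltr0n//=.
  by rewrite (le_lt_trans hi) ?ltry.
by rewrite fineK// ge0_fin_numE// (le_lt_trans hi)// ltry.
Qed.

(** The coordinates with respect to the edge vectors are the barycentric
    coordinates at the vertices other than the first. *)
Lemma affmap_edge_hull d (X : d.+1.-tuple (euclid R d)) y :
  edge_mx X \in unitmx ->
  Defs.convex_hull X (affmap (edge_mx X) (coord (tnth X ord0)) y) <-> std_simplex d y.
Proof.
move=> uE; set M := edge_mx X; split.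
  move=> [c [c0 c1 cE]].
  pose z := \col_k (c (lift ord0 k) - coord y k).
  have : M *m z = 0.
    apply/colP => j; rewrite !mxE.
    have := cE j; rewrite coord_affmap big_ord_recl.
    have -> : c ord0 = 1 - \sum_k c (lift ord0 k) by rewrite -c1 big_ord_recl addrK.
    move=> H.
    have E : \sum_k M j k * c (lift ord0 k) =
        \sum_k c (lift ord0 k) * coord (tnth X (lift ord0 k)) j -
        (\sum_k c (lift ord0 k)) * coord (tnth X ord0) j.
      by rewrite mulr_suml -sumrB; apply: eq_bigr => k _; rewrite mxE; ring.
    under eq_bigr do rewrite [X in _ * X]mxE mulrBr.
    rewrite sumrB; apply/eqP; rewrite subr_eq0; apply/eqP.
    by apply: (addIr (coord (tnth X ord0) j)); rewrite H E; ring.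
  move/(congr1 (mulmx (invmx M))); rewrite mulKmx// mulmx0 => z0.
  have yc k : coord y k = c (lift ord0 k).
    by have /colP/(_ k) := z0; rewrite !mxE => /eqP; rewrite subr_eq0 => /eqP.
  split=> [k|]; first by rewrite yc.
  by rewrite -c1 big_ord_recl (eq_bigr _ (fun k _ => yc k)) lerDr.
move=> [y0 y1].
exists (fun i => if unlift ord0 i is Some k then coord y k else 1 - \sum_k coord y k).
split.
- by move=> i; case: unliftP => [k _|_]//; rewrite subr_ge0.
- rewrite big_ord_recl unlift_none.
  rewrite [X in _ + X](eq_bigr (coord y)) ?subrK// => k _.
  by rewrite liftK.
- move=> j; rewrite coord_affmap big_ord_recl unlift_none.
  rewrite [X in _ = _ + X](eq_bigr
    (fun k => coord y k * coord (tnth X (lift ord0 k)) j)); last first.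
    by move=> k _; rewrite liftK.
  rewrite mulrBl mul1r mulr_suml addrC -addrA; congr (_ + _).
  rewrite addrC -sumrB; apply: eq_bigr => k _; rewrite mxE; ring.
Qed.

Lemma affmap_edge_inv d (X : d.+1.-tuple (euclid R d)) x : edge_mx X \in unitmx ->
  let N := invmx (edge_mx X) in
  affmap (edge_mx X) (coord (tnth X ord0))
    (affmap N (fun i => - \sum_j N i j * coord (tnth X ord0) j) x) = x.
Proof.
move=> uE N; apply: euclidP => i; rewrite coord_affmap.
have E j : coord (affmap N (fun i => - \sum_j N i j * coord (tnth X ord0) j) x) j =
    (N *m \col_k (coord x k - coord (tnth X ord0) k)) j ord0.
  rewrite coord_affmap !mxE -sumrB; apply: eq_bigr => k _.
  by rewrite !mxE mulrBr.
have : (edge_mx X *m (N *m \col_k (coord x k - coord (tnth X ord0) k))) i ord0 =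
    coord x i - coord (tnth X ord0) i by rewrite mulKVmx// mxE.
by rewrite mxE => H; under eq_bigr do rewrite E; rewrite H subrK.
Qed.

(** The constant is the volume of the standard simplex, of which the simplex
    is the image under an affine map whose linear part is [edge_mx X].  The
    convex hull is a measurable set because it is also the preimage of the
    standard simplex under the inverse map. *)
Lemma simplex_volume_det d : exists2 k : R, 0 < k &
  forall X : d.+1.-tuple (euclid R d), \det (simplex_mx X) != 0 ->
    simplex_volume X = `|\det (simplex_mx X)| * k.
Proof.
have [k k0 kE] := std_simplex_volume d; exists k => // X.
rewrite det_simplex_mx => X0; have uE : edge_mx X \in unitmx by rewrite unitmxE unitfE.
have hullE : affmap (edge_mx X) (coord (tnth X ord0)) @^-1` Defs.convex_hull X =
    std_simplex d.
  by apply/seteqP; split => y /(affmap_edge_hull y uE).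
rewrite /simplex_volume -(power_measure_affmap (coord (tnth X ord0)) uE).
  by rewrite hullE kE -EFinM.
pose N := invmx (edge_mx X).
rewrite [X in measurable X](_ : _ =
  affmap N (fun i => - \sum_j N i j * coord (tnth X ord0) j) @^-1` std_simplex d).
  rewrite -[X in measurable X]setTI; apply: measurable_affmap => //.
  exact: measurable_std_simplex.
apply/seteqP; split => x /=.
  by rewrite -{1}(affmap_edge_inv x uE) => /(affmap_edge_hull _ uE).
by move=> /(affmap_edge_hull _ uE); rewrite affmap_edge_inv.
Qed.

Lemma affinely_independent_det d (X : d.+1.-tuple (euclid R d)) :
  affinely_independent X -> \det (simplex_mx X) != 0.
Proof.
move=> aX; apply/negP => /eqP/eqP/det0P[c c0 cX]; case/negP: c0; apply/eqP/rowP => i.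
rewrite mxE; apply: (aX (c ord0)).
  have /rowP/(_ ord0) := cX; rewrite mxE [RHS]mxE => H; rewrite -[RHS]H.
  by apply: eq_bigr => k _; rewrite [X in _ * X]mxE homog0 mulr1.
move=> k; have /rowP/(_ (lift ord0 k)) := cX; rewrite mxE [RHS]mxE => H.
rewrite -[RHS]H.
by apply: eq_bigr => j _; rewrite [X in _ = _ * X]mxE homogS.
Qed.

End simplex.

(** * Negative powers of affine functions on the line *)

Section inverse_power.
Context {R : realType}.
Implicit Types (s x y : R).

(** The value at [0] is [+oo], so that the bounds below remain true, for trivial
    reasons, when the quantity on the right degenerates. *)
Definition inv_powR s y : \bar R :=
  if y == 0 then +oo%E else (`|y| `^ (- s))%:E.

Lemma inv_powR_neq0 s y : y != 0 -> inv_powR s y = (`|y| `^ (- s))%:E.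
Proof. by rewrite /inv_powR => /negbTE ->. Qed.

Lemma inv_powR_gt0 s y : (0 < inv_powR s y)%E.
Proof.
rewrite /inv_powR; case: ifPn => [_|y0]; first by rewrite ltry.
by rewrite lte_fin powR_gt0// normr_gt0.
Qed.

Lemma inv_powR_ge0 s y : (0 <= inv_powR s y)%E.
Proof. exact/ltW/inv_powR_gt0. Qed.

Lemma inv_powRM s x y : y != 0 ->
  inv_powR s (x * y) = (inv_powR s x * inv_powR s y)%E.
Proof.
move=> y0; have [->|x0] := eqVneq x 0.
  by rewrite mul0r {1 2}/inv_powR eqxx gt0_mulye// inv_powR_gt0.
by rewrite !inv_powR_neq0 ?mulf_neq0// normrM powRM// EFinM.
Qed.

Lemma inv_powR_norm s y : inv_powR s `|y| = inv_powR s y.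
Proof. by rewrite /inv_powR normr_eq0 normr_id. Qed.

Lemma inv_powR_le s x y : 0 <= s -> `|x| <= `|y| -> (inv_powR s y <= inv_powR s x)%E.
Proof.
move=> s0 xy; have [->|x0] := eqVneq x 0; first by rewrite {2}/inv_powR eqxx leey.
have y0 : y != 0 by rewrite -normr_gt0 (lt_le_trans _ xy)// normr_gt0.
rewrite !inv_powR_neq0// lee_fin !powRN lef_pV2 ?posrE ?powR_gt0 ?normr_gt0//.
by rewrite ge0_ler_powR ?nnegrE.
Qed.

Lemma measurable_inv_powR s : measurable_fun [set: measurableTypeR R] (inv_powR s).
Proof.
apply: measurable_fun_ifT => //.
  exact: measurable_fun_eqr.
apply/measurable_EFinP; apply: (measurableT_comp (measurable_powR _)) => //.
Qed.

(** The primitive [x ^ (1 - g) / (1 - g)] bounds the integrals over the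
    intervals that avoid the singularity; these exhaust the unit interval. *)
Lemma integral_inv_powR_01 (g : R) : g < 1 ->
  (\int[lebesgue_measure]_(x in `[0%R, 1%R]%classic) inv_powR g x <= ((1 - g)^-1)%:E)%E.
Proof.
move=> g1; have h0 : 0 < 1 - g by rewrite subr_gt0.
pose e n : R := n.+2%:R^-1.
pose I n : set R := `[e n, 1]%classic.
have e0 n : 0 < e n by rewrite invr_gt0.
have e1 n : e n < 1 by rewrite invf_lt1 ?ltr1n.
have mf (A : set (measurableTypeR R)) : measurable A -> measurable_fun A (inv_powR g).
  by move=> mA; apply: measurable_funTS; exact: measurable_inv_powR.
rewrite -integral_itv_obnd_cbnd; last exact: mf.
have -> : `]0, 1]%classic = \bigcup_n I n.
  apply/seteqP; split => x /=; rewrite in_itv/=.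
    move=> /andP[x0 x1].
    exists (Num.truncn x^-1) => //=; rewrite /I /= in_itv/= x1 andbT /e.
    rewrite -[leRHS]invrK lef_pV2 ?posrE ?invr_gt0//.
    by rewrite (le_trans (ltW (truncnS_gt _)))// ler_nat.
  by move=> [n _]; rewrite /I /= in_itv/= => /andP[/(lt_le_trans (e0 n)) -> ->].
have Ecvg : (\int[lebesgue_measure]_(x in I n) inv_powR g x @[n --> \oo] -->
    \int[lebesgue_measure]_(x in \bigcup_n I n) inv_powR g x)%E.
  apply: ge0_nondecreasing_set_cvg_integral => //.
  - apply/nondecreasing_seqP => n; rewrite subsetEset => x; rewrite /I /= !in_itv/=.
    move=> /andP[enx ->]; rewrite andbT (le_trans _ enx)//.
    by rewrite lef_pV2 ?posrE// ler_nat.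
  - by move=> n; exact: measurable_itv.
  - by move=> n; apply: mf; exact: measurable_itv.
  - by move=> n x _; exact: inv_powR_ge0.
rewrite -(cvg_lim _ Ecvg)//; apply: lime_le.
  by apply/cvg_ex; eexists; exact: Ecvg.
apply: nearW => n.
have : (\int[lebesgue_measure]_(x in I n) ((1 - g) * x `^ (- g))%:E =
    (1 `^ (1 - g))%:E - ((e n) `^ (1 - g))%:E)%E.
  have dF x : 0 < x -> derivable (@powR R ^~ (1 - g)) x 1.
    by move=> x0; apply: derivable_powR; rewrite in_itv/= x0.
  have cF x : 0 < x -> {for x, continuous (@powR R ^~ (1 - g))}.
    by move=> /dF/derivable1_diffP/differentiable_continuous.
  apply: (@continuous_FTC2 _ _ (@powR R ^~ (1 - g))) => //.
  - apply: derivable_within_continuous => x; rewrite in_itv/= => /andP[ex _].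
    apply: derivableM => //; apply: derivable_powR; rewrite in_itv/= andbT.
    exact: lt_le_trans ex.
  - split.
    + by move=> x; rewrite in_itv/= => /andP[/(lt_trans (e0 n)) x0 _]; exact: dF.
    + exact/cvg_at_right_filter/cF.
    + exact/cvg_at_left_filter/cF.
  - move=> x; rewrite in_itv/= => /andP[/(lt_trans (e0 n)) x0 _].
    rewrite powR_derive1 ?in_itv/= ?x0//; congr (_ * _ `^ _); ring.
rewrite (eq_integral
  (fun x : measurableTypeR R => (1 - g)%:E * inv_powR g x)%E); last first.
  move=> x; rewrite inE /I /= in_itv/= => /andP[/(lt_le_trans (e0 n)) x0 _].
  by rewrite inv_powR_neq0 ?gt_eqF// gtr0_norm// EFinM.
rewrite ge0_integralZl//; last 4 first.
- exact: measurable_itv.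
- by apply: mf; exact: measurable_itv.
- by move=> x _; exact: inv_powR_ge0.
- by rewrite lee_fin ltW.
move=> H; rewrite -(@lee_pmul2l _ (1 - g)%:E)// H -EFinM mulfV ?gt_eqF// powR1.
  by rewrite -EFinB lee_fin gerBl powR_ge0.
Qed.

Lemma measurable_inv_powR_indic g (A : set (measurableTypeR R)) : measurable A ->
  measurable_fun setT
    (fun x : measurableTypeR R => inv_powR g x * (\1_A x)%:E)%E.
Proof.
move=> mA; apply: emeasurable_funM; first exact: measurable_inv_powR.
by apply/measurable_EFinP/measurable_indic.
Qed.

Lemma inv_powR_indic_ge0 d (T : measurableType d) g (f : T -> R) (A : set T) (x : T) :
  (0 <= inv_powR g (f x) * (\1_A x)%:E)%E.
Proof. by rewrite mule_ge0 ?inv_powR_ge0// lee_fin. Qed.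

Lemma integral_inv_powR_unit (g : R) : g < 1 -> exists2 C : R, 0 < C &
  (\int[lebesgue_measure]_x (inv_powR g x *
     (\1_(`[(-1)%R, 1%R]%classic : set (measurableTypeR R)) x)%:E) <= C%:E)%E.
Proof.
move=> g1; have h0 : 0 < 1 - g by rewrite subr_gt0.
exists (2 * (1 - g)^-1); first by rewrite mulr_gt0// invr_gt0.
pose F (x : measurableTypeR R) :=
  (inv_powR g x * (\1_(`[0%R, 1%R]%classic : set (measurableTypeR R)) x)%:E)%E.
have mF : measurable_fun setT F.
  by apply: measurable_inv_powR_indic; exact: measurable_itv.
have F0 x : (0 <= F x)%E by exact: inv_powR_indic_ge0.
have FE : (\int[lebesgue_measure]_x F x =
    \int[lebesgue_measure]_(x in `[0%R, 1%R]%classic) inv_powR g x)%E.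
  rewrite [RHS]integral_mkcond; apply: eq_integral => x _.
  by rewrite /F epatch_indic.
have FN : (\int[lebesgue_measure]_x F (affine1 (-1) 0 x) =
    \int[lebesgue_measure]_x F x)%E.
  rewrite -[LHS]mul1e -[1%E]/(1%:E)%E.
  apply: (@ge0_integral_scaled_pushforward _ _ _ _ _ _ _ (affine1 (-1) 0)) => //.
    exact: measurable_affine1.
  move=> A mA; have N1 : (- 1 : R) != 0 by rewrite oppr_eq0 oner_eq0.
  by have := lebesgue_measure_affine1 0 N1 mA; rewrite normrN1.
have mFN : measurable_fun setT (fun x => F (affine1 (-1) 0 x)).
  by apply: measurableT_comp mF _; exact: measurable_affine1.
apply: (@le_trans _ _ (\int[lebesgue_measure]_x (F x + F (affine1 (-1) 0 x)))%E).
  apply: ge0_le_integral => //.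
  - by move=> x _; exact: inv_powR_indic_ge0.
  - by apply: measurable_inv_powR_indic; exact: measurable_itv.
  - exact: emeasurable_funD.
  move=> x _; rewrite /F /affine1 addr0 mulN1r -(inv_powR_norm _ (- x)) normrN.
  rewrite inv_powR_norm -ge0_muleDr ?lee_fin//.
  rewrite lee_wpmul2l ?inv_powR_ge0// -EFinD lee_fin !indicE !mem_setE !in_itv/=.
  rewrite oppr_ge0 lerNl.
  have [/andP[h1 h2]|_] := boolP ((- x <= 1) && (x <= 1)); last first.
    by rewrite addr_ge0.
  by have [x0|/ltW x0] := leP 0 x; rewrite ?h1 ?h2 ?x0/= ?lerDl ?lerDr.
rewrite ge0_integralD// FN FE mulr_natl EFin_natmul mule2n.
by apply: leeD; exact: integral_inv_powR_01.
Qed.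

(** The point is the uniformity in the position [b] of the singularity.
    After scaling by [r], the integrand is at most [1] at distance at least [1]
    from the singularity, and within distance [1] the integral is the one over
    the unit interval. *)
Lemma integral_inv_powR_affine (g : R) : 0 <= g -> g < 1 -> exists2 C : R, 0 < C &
  forall a b r, a != 0 -> 0 < r ->
  (\int[lebesgue_measure]_x (inv_powR g (a * x + b) *
     (\1_(`[(- r)%R, r]%classic : set (measurableTypeR R)) x)%:E) <=
   (C * r `^ (1 - g))%:E * inv_powR g a)%E.
Proof.
move=> g0 g1; have [C0 C00 HC] := integral_inv_powR_unit g1.
exists (2 + C0); first by rewrite addr_gt0.
move=> a b r a0 r0; have rn0 : r != 0 by rewrite gt_eqF.
pose I s : set (measurableTypeR R) := `[- s, s]%classic.
have mI s : measurable (I s) by exact: measurable_itv.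
pose F (x : measurableTypeR R) := (inv_powR g x * (\1_(I 1) x)%:E)%E.
have mF : measurable_fun setT F by exact: measurable_inv_powR_indic.
have F0 x : (0 <= F x)%E by exact: inv_powR_indic_ge0.
pose u := affine1 r^-1 (r^-1 * (b / a)).
have uE x : a * x + b = u x * r * a.
  by rewrite /u /affine1; field; rewrite a0 gt_eqF.
have mu : measurable_fun setT u by exact: measurable_affine1.
have FuE : (\int[lebesgue_measure]_x F (u x) = r%:E * \int[lebesgue_measure]_x F x)%E.
  have H : ((r^-1)%R%:E * \int[lebesgue_measure]_x F (u x) =
      \int[lebesgue_measure]_x F x)%E.
    apply: (@ge0_integral_scaled_pushforward _ _ _ _ _ _ _ u) => //.
      by rewrite invr_ge0 ltW.
    move=> A mA; have ri0 : r^-1 != 0 by rewrite invr_eq0 gt_eqF.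
    have := lebesgue_measure_affine1 (r^-1 * (b / a)) ri0 mA.
    by rewrite gtr0_norm ?invr_gt0.
  by rewrite -H muleA -EFinM mulfV ?gt_eqF// mul1e.
have mFu : measurable_fun setT (F \o u) by exact: measurableT_comp.
pose k := r `^ (- g) * `|a| `^ (- g).
have k0 : 0 <= k by rewrite mulr_ge0 ?powR_ge0.
have kE : (inv_powR g r * inv_powR g a)%E = k%:E.
  by rewrite (inv_powR_neq0 _ rn0) (inv_powR_neq0 _ a0) (gtr0_norm r0).
have m1 s : measurable_fun setT
    (fun x : measurableTypeR R => ((\1_(I s) x)%:E : \bar R)).
  by apply/measurable_EFinP/measurable_indic.
apply: (@le_trans _ _ (\int[lebesgue_measure]_x
    (k%:E * ((\1_(I r) x)%:E + F (u x))))%E).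
  apply: ge0_le_integral => //.
  - by move=> x _; exact: inv_powR_indic_ge0.
  - apply: emeasurable_funM; last exact: (m1 r).
    apply: (@measurableT_comp _ _ _ _ _ _ _ _ (affine1 a b)).
      exact: measurable_inv_powR.
    exact: measurable_affine1.
  - by apply: measurable_funeM; apply: emeasurable_funD.
  move=> x _; rewrite uE (inv_powRM _ _ a0) (inv_powRM _ _ rn0) -kE.
  rewrite -(muleA (inv_powR g (u x))) (muleC (inv_powR g (u x))) -muleA.
  rewrite lee_wpmul2l//.
    by rewrite mule_ge0 ?inv_powR_ge0.
  have [xI|xI] := boolP (x \in I r); last first.
    by rewrite -/(I r) indicE (negbTE xI) mule0 add0e.
  rewrite -/(I r) indicE xI mule1 /F indicE; have [u1|u1] := boolP (u x \in I 1).
    by rewrite mule1 leeDr.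
  rewrite mule0 adde0; apply: (@le_trans _ _ (inv_powR g 1)).
    rewrite inv_powR_le// normr1 ltW// ltNge; apply: contra u1.
    by rewrite ler_norml inE /I /= in_itv.
  by rewrite inv_powR_neq0 ?oner_eq0// normr1 powR1.
rewrite ge0_integralZl//; last 2 first.
- by apply: emeasurable_funD.
- by move=> x _; rewrite adde_ge0// lee_fin.
rewrite ge0_integralD//.
rewrite FuE integral_indic// setIT.
have LI : lebesgue_measure (I r) = (2 * r)%:E.
  rewrite lebesgue_measure_itv/= lte_fin gtrN//.
  by rewrite -EFinD opprK mulr_natl mulr2n.
apply: (@le_trans _ _ (k%:E * ((2 * r)%:E + r%:E * C0%:E))%E).
  rewrite lee_wpmul2l ?lee_fin//; apply: leeD; first by rewrite -LI.
  by rewrite lee_wpmul2l ?lee_fin// ltW.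
rewrite -(EFinM r) -EFinD -EFinM (inv_powR_neq0 _ a0) -EFinM lee_fin.
have -> : r `^ (1 - g) = r * r `^ (- g).
  by rewrite powRD ?rn0 ?implybT// powRr1// ltW.
rewrite le_eqVlt; apply/orP; left; apply/eqP; rewrite /k; ring.
Qed.

End inverse_power.

(** * Annuli and reflections *)

Section annuli.
Context {R : realType}.

Local Notation leb n := (power_measure (@lebesgue_measure R) (n := n)).

Definition normsq n (t : euclid R n) : R := \sum_k coord t k ^+ 2.

Lemma measurable_normsq n :
  measurable_fun setT (normsq (n := n) : _ -> measurableTypeR R).
Proof.
apply: measurable_sum => k; apply: measurable_funX; exact: measurable_coord.
Qed.

Lemma measurable_normsq_preimage n (A : set (measurableTypeR R)) :
  measurable A -> measurable [set t : euclid R n | A (normsq t)].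
Proof.
by move=> mA; rewrite -[X in measurable X]setTI; exact: measurable_normsq.
Qed.

(** By homogeneity; the unit ball has finite volume since it lies in a cube. *)
Lemma ball_volume n : exists2 v : R, 0 <= v & forall s, 0 < s ->
  leb n [set t | normsq t <= s ^+ 2] = (v * s ^+ n)%:E.
Proof.
pose B (s : R) := [set t : euclid R n | normsq t <= s ^+ 2].
have mB s : measurable (B s).
  apply: (@measurable_normsq_preimage _ `]-oo, s ^+ 2]%classic).
  exact: measurable_itv.
have Boo : (leb n (B 1%R) < +oo)%E.
  pose I : set (measurableTypeR R) := `[(-1), 1]%classic.
  have mI : measurable I by exact: measurable_itv.
  apply: (@le_lt_trans _ _ (leb n [set t | forall i, I (tnth t i)])).
    apply: le_measure; rewrite ?inE//; first exact: (@measurable_box _ _ _ (fun=> I)).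
    move=> t; rewrite /B /= expr1n => t1 i; rewrite /I /= in_itv/=.
    have : coord t i ^+ 2 <= 1.
      apply: le_trans t1; rewrite /normsq (bigD1 i)//= lerDl sumr_ge0// => j _.
      exact: sqr_ge0.
    by rewrite -/(coord t i) => h; apply/andP; split; nra.
  have LI : lebesgue_measure I = 2%:E.
    by rewrite lebesgue_measure_itv/= lte_fin gtrN// -EFinD opprK.
  rewrite [ltLHS](_ : _ = \prod_(i < n) 2%:E)%E; last first.
    transitivity (\prod_(i < n) lebesgue_measure I)%E.
      by apply: (@power_measure_box _ _ R (@lebesgue_measure R) n (fun=> I)).
    by apply: eq_bigr => i _; exact: LI.
  by rewrite prodEFin ltry.
exists (fine (leb n (B 1))); first exact: fine_ge0.
move=> s s0; have us : (s%:M : 'M[R]_n) \in unitmx.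
  by rewrite unitmxE det_scalar unitfE expf_neq0// gt_eqF.
rewrite -/(B s) -(power_measure_affmap (fun=> 0) us)// det_scalar mulrC EFinM.
rewrite ger0_norm ?exprn_ge0 ?ltW// fineK ?ge0_fin_numE//.
congr (_ * _)%E; congr (power_measure _ _).
have E t : normsq (affmap s%:M (fun=> 0) t) = s ^+ 2 * normsq t.
  rewrite mulr_sumr; apply: eq_bigr => k _; rewrite coord_affmap addr0.
  rewrite (bigD1 k)//= big1 ?addr0 ?mxE ?eqxx ?mulr1n ?exprMn// => j jk.
  by rewrite mxE eq_sym (negbTE jk) mulr0n mul0r.
apply/seteqP; split => t /=; rewrite /B /= E expr1n.
  by rewrite -ler_pdivlMl ?exprn_gt0// mulVf// expf_neq0// gt_eqF.
by move=> ?; rewrite ler_piMr// sqr_ge0.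
Qed.

(** The exponent is at least [2], which is what makes the [k]-th power a
    Lipschitz function of the square. *)
Lemma subrX_le_sqr m (a b : R) : 0 <= a -> a <= b ->
  b ^+ m.+2 - a ^+ m.+2 <= m.+2%:R * b ^+ m * (b ^+ 2 - a ^+ 2).
Proof.
move=> a0 ab; have b0 := le_trans a0 ab.
rewrite subrXX.
apply: (@le_trans _ _ ((b - a) * (m.+2%:R * b ^+ m.+1))).
  rewrite ler_wpM2l ?subr_ge0//.
  apply: (@le_trans _ _ (\sum_(i < m.+2) b ^+ m.+1)).
    apply: ler_sum => i _; have im : (i <= m.+1)%N by rewrite -ltnS.
    rewrite -[in leRHS](subnK im) exprD ler_wpM2l ?exprn_ge0//.
    by rewrite lerXn2r ?nnegrE.
  by rewrite sumr_const card_ord mulr_natl.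
rewrite exprS subr_sqr.
have -> : (b - a) * (m.+2%:R * (b * b ^+ m)) = m.+2%:R * b ^+ m * ((b - a) * b) by ring.
rewrite ler_wpM2l ?mulr_ge0 ?exprn_ge0//.
by rewrite ler_wpM2l ?subr_ge0// lerDl.
Qed.

(** In dimension at least [2] the volume of an annulus is controlled by the
    difference of the squared radii, however thin or small the annulus is.  In
    dimension [1] this fails for annuli with a small outer radius. *)
Lemma annulus_volume m : exists2 K : R, 0 < K & forall r a b : R,
  0 < r -> a <= b -> 0 < b -> b <= r ^+ 2 ->
  (leb m.+2 [set t | (a < normsq t <= b)%R] <= (K * r ^+ m * (b - a))%:E)%E.
Proof.
have [v v0 vE] := ball_volume m.+2; exists (1 + v * m.+2%:R).
  by rewrite ltr_wpDr// mulr_ge0.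
move=> r a b r0 ab b0 br.
pose B (s : R) := [set t : euclid R m.+2 | normsq t <= s ^+ 2].
have mB s : measurable (B s).
  apply: (@measurable_normsq_preimage _ `]-oo, s ^+ 2]%classic).
  exact: measurable_itv.
have mA : measurable [set t : euclid R m.+2 | a < normsq t <= b].
  have := @measurable_normsq_preimage m.+2 `]a, b]%classic (measurable_itv _).
  by congr measurable; apply/seteqP; split => t /=; rewrite in_itv.
pose beta := Num.sqrt b; have beta0 : 0 < beta by rewrite sqrtr_gt0.
have betab : beta ^+ 2 = b by rewrite sqr_sqrtr ?ltW.
have betar : beta <= r by rewrite -ler_sqr ?nnegrE ?(ltW r0) ?(ltW beta0)// betab.
have last_step (c : R) : 0 <= c -> c <= v * m.+2%:R * beta ^+ m * (b - a) ->
    c <= (1 + v * m.+2%:R) * r ^+ m * (b - a).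
  move=> c0 /le_trans; apply; rewrite ler_wpM2r ?subr_ge0//.
  apply: ler_pM; [by rewrite mulr_ge0|by rewrite exprn_ge0// ltW| |].
  - by rewrite lerDr.
  - by rewrite lerXn2r ?nnegrE// ltW.
(* For [a <= 0] the annulus lies in a ball whose squared radius is at most
   [b - a]. *)
have [a0|a0] := leP a 0.
  apply: (@le_trans _ _ (leb m.+2 (B beta))).
    apply: le_measure; rewrite ?inE// => t /=; rewrite /B /= betab.
    by move=> /andP[].
  rewrite vE// lee_fin; apply: last_step.
    by rewrite mulr_ge0// exprn_ge0// ltW.
  have -> : v * beta ^+ m.+2 = v * beta ^+ m * b.
    by rewrite !exprS -betab; ring.
  have -> : v * m.+2%:R * beta ^+ m * (b - a) =
      v * beta ^+ m * (m.+2%:R * (b - a)) by ring.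
  rewrite ler_wpM2l ?mulr_ge0 ?exprn_ge0// ?(ltW beta0)//.
  have h : b <= b - a by rewrite lerDl oppr_ge0.
  by apply: (le_trans h); rewrite ler_peMl ?ler1n// (le_trans (ltW b0) h).
pose alpha := Num.sqrt a; have alpha0 : 0 < alpha by rewrite sqrtr_gt0.
have alphaa : alpha ^+ 2 = a by rewrite sqr_sqrtr ?ltW.
have alphab : alpha <= beta by rewrite ler_wsqrtr.
have -> : [set t : euclid R m.+2 | a < normsq t <= b] = B beta `\` B alpha.
  apply/seteqP; split => t /=; rewrite /B /= betab alphaa ltNge.
    by move=> /andP[/negP].
  by move=> [-> /negP ->].
have -> : leb m.+2 (B beta `\` B alpha) =
    (leb m.+2 (B beta) - leb m.+2 (B beta `&` B alpha))%E.
  by apply: measureD => //; rewrite [ltLHS](vE _ beta0) ltry.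
rewrite setIidr; last first.
  by move=> t; rewrite /B /= alphaa betab => /le_trans; apply.
rewrite !vE// -EFinB lee_fin -mulrBr; apply: last_step.
  by rewrite mulr_ge0// subr_ge0 lerXn2r ?nnegrE// ltW.
have -> : v * m.+2%:R * beta ^+ m * (b - a) =
    v * (m.+2%:R * beta ^+ m * (beta ^+ 2 - alpha ^+ 2)).
  by rewrite betab alphaa; ring.
by rewrite ler_wpM2l// subrX_le_sqr// ltW.
Qed.

End annuli.

Section householder.
Context {R : realType}.

Local Notation leb n := (power_measure (@lebesgue_measure R) (n := n)).

(** The reflection that exchanges the vector [c] with its multiple of the first
    basis vector of the same length. *)
Lemma householder n (c : 'cV[R]_n.+1) : exists Q : 'M[R]_n.+1,
  [/\ Q^T = Q, Q *m Q = 1%:M &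
      Q *m c = Num.sqrt (\sum_k c k 0 ^+ 2) *: delta_mx 0 0].
Proof.
set rho := Num.sqrt _; pose e : 'cV[R]_n.+1 := delta_mx 0 0.
have rho2 : rho ^+ 2 = \sum_k c k 0 ^+ 2.
  by rewrite sqr_sqrtr// sumr_ge0// => k _; exact: sqr_ge0.
pose v := c - rho *: e.
have dotE (x y : 'cV[R]_n.+1) : x^T *m y = (\sum_k x k 0 * y k 0)%:M.
  apply/matrixP => i j; rewrite !ord1 !mxE eqxx mulr1n.
  by apply: eq_bigr => k _; rewrite mxE.
have [v0|v0] := eqVneq v 0.
  exists 1%:M; rewrite trmx1 mul1mx mul1mx; split => //.
  by apply/eqP; rewrite -subr_eq0 -/e -/v v0.
pose N := \sum_k v k 0 * v k 0.
have N0 : N != 0.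
  apply: contra v0 => /eqP H; apply/eqP/matrixP => i j; rewrite ord1 [RHS]mxE.
  have /psumr_eq0P : \sum_(k < n.+1) v k 0 * v k 0 = 0 by [].
  move=> /(_ (fun k _ => sqr_ge0 (v k 0)) i isT)/eqP.
  by rewrite mulf_eq0 orbb => /eqP.
have ce : \sum_k e k 0 * c k 0 = c 0 0.
  rewrite (bigD1 0)//= big1 ?addr0 ?mxE ?eqxx ?mul1r// => k k0.
  by rewrite mxE (negbTE k0) mul0r.
have ee : \sum_k e k 0 * e k 0 = 1.
  rewrite (bigD1 0)//= big1 ?addr0 ?mxE ?eqxx ?mul1r// => k k0.
  by rewrite mxE (negbTE k0) mul0r.
have NE : N = 2 * \sum_k v k 0 * c k 0.
  have vE k : v k 0 = c k 0 - rho * e k 0 by rewrite /v !mxE.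
  have -> : \sum_k v k 0 * c k 0 = rho ^+ 2 - rho * c 0 0.
    rewrite -ce rho2 mulr_sumr -sumrB; apply: eq_bigr => k _; rewrite vE; ring.
  have -> : N = \sum_k c k 0 ^+ 2 - 2 * rho * (\sum_k e k 0 * c k 0) +
      rho ^+ 2 * (\sum_k e k 0 * e k 0).
    rewrite !mulr_sumr -sumrB -big_split/=; apply: eq_bigr => k _; rewrite vE; ring.
  by rewrite ce ee -rho2; ring.
pose Q := 1%:M - (2 / N) *: (v *m v^T).
exists Q; split.
- by rewrite /Q linearB linearZ/= trmx_mul trmxK trmx1.
- have H : v *m v^T *m (v *m v^T) = N *: (v *m v^T).
    by rewrite mulmxA -[v *m v^T *m v]mulmxA dotE mul_mx_scalar -scalemxAl.
  rewrite /Q; move: (v *m v^T) H => W H.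
  rewrite mulmxBr mulmx1 mulmxBl mul1mx -scalemxAl -scalemxAr H !scalerA.
  have -> : 2 / N * (2 / N) * N = 2 / N + 2 / N by field.
  rewrite scalerDl; move: (2 / N *: W) => Z.
  have -> : Z - (Z + Z) = - Z by rewrite opprD addrA subrr sub0r.
  by rewrite opprK subrK.
- rewrite /Q mulmxBl mul1mx -scalemxAl -mulmxA dotE mul_mx_scalar scalerA.
  have -> : 2 / N * (\sum_k v k 0 * c k 0) = 1.
    by rewrite mulrAC -NE mulfV.
  by rewrite scale1r /v opprB addrC subrK.
Qed.

End householder.

(** * Negative powers of affine functions on a spherical shell *)

Section slab.
Context {R : realType}.

Local Notation leb n := (power_measure (@lebesgue_measure R) (n := n)).

Lemma sphere_shellE n (p : euclid R n) (r w : R) : 0 < w -> w <= r ->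
  sphere_shell p r w =
  [set x | (r - w) ^+ 2 <= \sum_k (coord x k - coord p k) ^+ 2 <= r ^+ 2].
Proof.
move=> w0 wr; have rw : 0 <= r - w by rewrite subr_ge0.
have r0 : 0 <= r by rewrite (le_trans (ltW w0)).
apply/seteqP; split => x; rewrite /sphere_shell /edist /= => /andP[h1 h2];
  have S0 : 0 <= \sum_k (coord x k - coord p k) ^+ 2
    by apply: sumr_ge0 => k _; exact: sqr_ge0.
- by rewrite -[X in _ <= X <= _](sqr_sqrtr S0) !lerXn2r ?nnegrE// sqrtr_ge0.
- rewrite -[X in X <= _](ger0_norm rw) -sqrtr_sqr ler_wsqrtr//=.
  by rewrite -[leRHS](ger0_norm r0) -sqrtr_sqr ler_wsqrtr.
Qed.

Lemma measurable_sphere_shell n (p : euclid R n) (r w : R) : 0 < w -> w <= r ->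
  measurable (sphere_shell p r w).
Proof.
move=> w0 wr; rewrite sphere_shellE//.
pose f (x : euclid R n) : measurableTypeR R := \sum_k (coord x k - coord p k) ^+ 2.
have mf : measurable_fun setT f.
  apply: measurable_sum => k; apply: measurable_funX; apply: measurable_funB => //.
  exact: measurable_coord.
rewrite (_ : [set _ | _] = f @^-1` `[(r - w) ^+ 2, r ^+ 2]%classic).
  by rewrite -[X in measurable X]setTI; apply: mf => //; exact: measurable_itv.
by apply/seteqP; split => x /=; rewrite in_itv.
Qed.

(** Coordinates centred at [p] whose first axis is parallel to [c]: in them the
    shell around [p] is centred at the origin and an affine function with
    gradient [c] depends only on the first coordinate. *)
Lemma orthogonal_frame n (c : 'I_n.+1 -> R) (p : euclid R n.+1) :
  exists Q : 'M[R]_n.+1, let phi := affmap Q (coord p) in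
  [/\ `|\det Q| = 1,
      forall y, \sum_k (coord (phi y) k - coord p k) ^+ 2 = normsq y &
      forall y, \sum_k c k * coord (phi y) k =
        Num.sqrt (\sum_k c k ^+ 2) * coord y ord0 + \sum_k c k * coord p k].
Proof.
have [Q [QT QQ Qc]] := householder (\col_k c k); exists Q.
have phiE y k : coord (affmap Q (coord p) y) k =
    (Q *m \col_j coord y j) k 0 + coord p k.
  by rewrite coord_affmap mxE; congr (_ + _); apply: eq_bigr => j _; rewrite mxE.
have dotE (x y : 'cV[R]_n.+1) : \sum_k x k 0 * y k 0 = (x^T *m y) 0 0.
  by rewrite mxE; apply: eq_bigr => k _; rewrite mxE.
split.
- apply/eqP; rewrite -(@eqrXn2 _ 2)// expr1n -normrX expr2 -det_mulmx QQ det1.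
  by rewrite normr1.
- move=> y; under eq_bigr do rewrite phiE addrK expr2.
  rewrite dotE trmx_mul QT -mulmxA (mulmxA Q) QQ mul1mx -dotE.
  by apply: eq_bigr => k _; rewrite mxE expr2.
- move=> y; under eq_bigr do rewrite phiE mulrDr.
  rewrite big_split/=; congr (_ + _).
  transitivity (\sum_k (\col_k c k) k 0 * (Q *m \col_j coord y j) k 0).
    by apply: eq_bigr => k _; rewrite [X in _ = X * _]mxE.
  rewrite dotE -{1}QT mulmxA -trmx_mul Qc linearZ/= trmx_delta -scalemxAl mxE.
  congr (_ * _).
    by congr Num.sqrt; apply: eq_bigr => k _; rewrite mxE.
  by rewrite -rowE !mxE.
Qed.

(** In the coordinates of [orthogonal_frame] the integrand only depends on the
    first coordinate, the shell lies over the interval from [- r] to [r], and its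
    sections are annuli whose squared radii differ by at most [2 w r].  The
    length of the gradient is then weakened to the absolute value of one of
    its coordinates. *)
Lemma slab_integral m (g : R) : 0 <= g -> g < 1 -> exists2 C : R, 0 < C &
  forall (p : euclid R m.+3) (r w : R), 0 < w -> w <= r ->
  forall (c : 'I_m.+3 -> R) (b : R) s, c s != 0 ->
  (\int[leb m.+3]_x (inv_powR g (\sum_k c k * coord x k + b) *
     (\1_(sphere_shell p r w) x)%:E) <=
   (C * (w * r ^+ m.+1 * r `^ (1 - g)))%:E * inv_powR g (c s))%E.
Proof.
move=> g0 g1; have [K K0 annK] := @annulus_volume R m.
have [C1 C10 C1P] := integral_inv_powR_affine g0 g1.
exists (K * 2 ^+ m * 4 * C1); first by rewrite !mulr_gt0// exprn_gt0.
move=> p r w w0 wr c b s cs0.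
have r0 : 0 < r by exact: lt_le_trans wr.
have [Q] := orthogonal_frame c p; set phi := affmap Q (coord p).
set rho := Num.sqrt _; move=> [detQ normQ dotQ].
have rhos : `|c s| <= `|rho|.
  rewrite [leRHS]ger0_norm ?sqrtr_ge0// -sqrtr_sqr ler_wsqrtr//.
  by rewrite (bigD1 s)//= lerDl sumr_ge0// => k _; exact: sqr_ge0.
have rho0 : rho != 0 by rewrite -normr_gt0 (lt_le_trans _ rhos)// normr_gt0.
pose b' := \sum_k c k * coord p k + b.
pose S := [set y : euclid R m.+3 | (r - w) ^+ 2 <= normsq y <= r ^+ 2].
pose I : set (measurableTypeR R) := `[- r, r]%classic.
have mf : measurable_fun setT (fun x : euclid R m.+3 =>
    inv_powR g (\sum_k c k * coord x k + b) * (\1_(sphere_shell p r w) x)%:E)%E.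
  apply: emeasurable_funM.
    apply: (@measurableT_comp _ _ _ _ _ _ (@inv_powR R g)).
      exact: measurable_inv_powR.
    exact: measurable_affine.
  by apply/measurable_EFinP/measurable_indic; exact: measurable_sphere_shell.
have mphi : measurable_fun setT phi by exact: measurable_affmap.
have detQ0 : Q \in unitmx by rewrite unitmxE unitfE -normr_eq0 detQ oner_eq0.
have -> : (\int[leb m.+3]_x (inv_powR g (\sum_k c k * coord x k + b) *
     (\1_(sphere_shell p r w) x)%:E) =
   \int[leb m.+3]_y ((\1_S y)%:E * inv_powR g (rho * coord y ord0 + b')))%E.
  rewrite -(ge0_integral_scaled_pushforward (m1 := leb m.+3) (phi := phi)
    (k := 1) _ _ _ mf)//.
  - rewrite mul1e; apply: eq_integral => y _; rewrite muleC dotQ -addrA.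
    congr (_%:E * _)%E; rewrite !indicE; congr ((nat_of_bool _)%:R); apply/idP/idP.
      by rewrite !inE sphere_shellE//= normQ.
    by rewrite !inE sphere_shellE//= normQ.
  - by move=> A mA; rewrite -detQ; exact: power_measure_affmap.
  - by move=> y; exact: inv_powR_indic_ge0.
have mS : measurable S.
  have := @measurable_normsq_preimage R m.+3
    `[(r - w) ^+ 2, r ^+ 2]%classic (measurable_itv _).
  by congr measurable; apply/seteqP; split => t /=; rewrite in_itv.
have mh : measurable_fun setT (fun y : euclid R m.+3 =>
    (\1_S y)%:E * inv_powR g (rho * coord y ord0 + b'))%E.
  apply: emeasurable_funM; first exact/measurable_EFinP/measurable_indic.
  apply: (@measurableT_comp _ _ _ _ _ _ (@inv_powR R g)).
    exact: measurable_inv_powR.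
  apply: (measurableT_comp (measurable_affine1 rho b')); exact: measurable_coord.
have h0 (y : euclid R m.+3) :
    (0 <= (\1_S y)%:E * inv_powR g (rho * coord y ord0 + b'))%E.
  by rewrite mule_ge0 ?inv_powR_ge0// lee_fin.
rewrite ge0_integral_power_measureS//.
have mG : measurable_fun setT (fun x : measurableTypeR R =>
    inv_powR g (rho * x + b') * (\1_I x)%:E)%E.
  apply: emeasurable_funM.
    apply: (measurableT_comp (measurable_inv_powR g)).
    exact: (measurable_affine1 rho b').
  by apply/measurable_EFinP/measurable_indic; exact: measurable_itv.
pose K' := K * 2 ^+ m * 4 * w * r ^+ m.+1.
have K'0 : 0 <= K' by rewrite /K' !mulr_ge0 ?exprn_ge0// ltW.
apply: (@le_trans _ _ (\int[lebesgue_measure]_x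
    (K'%:E * (inv_powR g (rho * x + b') * (\1_I x)%:E)))%E).
  apply: ge0_le_integral => //.
  - by move=> x _; apply: integral_ge0 => t _.
  - exact: (measurable_fun_integral_cons _ mh h0).
  - exact: measurable_funeM.
  move=> x _; pose Sx := [set t : euclid R m.+2 | S [tuple of x :: t]].
  have mSx : measurable Sx by exact: measurable_slice.
  rewrite (eq_integral
    (fun t => (\1_Sx t)%:E * inv_powR g (rho * x + b'))%E); last first.
    by move=> t _; congr (_%:E * inv_powR g (rho * _ + b'))%E.
  rewrite ge0_integralZr ?inv_powR_ge0//; last first.
    exact/measurable_EFinP/measurable_indic.
  rewrite integral_indic// setIT muleCA [leLHS]muleC lee_wpmul2l ?inv_powR_ge0//.
  have SxE t : Sx t = ((r - w) ^+ 2 <= x ^+ 2 + normsq t <= r ^+ 2) :> Prop.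
    rewrite /Sx /S /= /normsq big_ord_recl /coord tnth0.
    by under eq_bigr do rewrite tnthS.
  have [xI|xI] := boolP (x \in I); last first.
    rewrite (_ : Sx = set0) ?measure0 ?mule_ge0 ?lee_fin//.
    apply/seteqP; split => // t /=; rewrite SxE => /andP[_ h]; case/negP: xI.
    rewrite inE /I /= in_itv/=.
    have N0 : 0 <= normsq t by apply: sumr_ge0 => k _; exact: sqr_ge0.
    by apply/andP; split; nra.
  rewrite indicE xI mule1.
  (* Widening the annulus by [w r] on both sides makes it half-open and keeps
     its outer radius positive, at the cost of a factor [2] in the width. *)
  pose bb := r ^+ 2 - x ^+ 2 + w * r; pose aa := (r - w) ^+ 2 - x ^+ 2 - w * r.
  have xr : x ^+ 2 <= r ^+ 2.
    by move: xI; rewrite inE /I /= in_itv/= => /andP[? ?]; nra.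
  have wr0 : 0 < w * r by rewrite mulr_gt0.
  apply: (@le_trans _ _ (leb m.+2 [set t | (aa < normsq t <= bb)%R])).
    apply: le_measure; rewrite ?inE//.
      have := @measurable_normsq_preimage R m.+2 `]aa, bb]%classic (measurable_itv _).
      by congr measurable; apply/seteqP; split => t /=; rewrite in_itv.
    move=> t; rewrite SxE /= /aa /bb => /andP[h1 h2].
    by apply/andP; split; lra.
  have r20 : 0 < 2 * r by rewrite mulr_gt0.
  apply: le_trans (annK (2 * r) aa bb r20 _ _ _) _; rewrite /aa /bb.
  - by nra.
  - by nra.
  - by nra.
  rewrite lee_fin /K' exprMn (exprS r m).
  rewrite [leRHS](_ : _ = K * (2 ^+ m * r ^+ m) * (4 * w * r)); last by ring.
  rewrite ler_wpM2l ?mulr_ge0 ?exprn_ge0 ?ltW//; nra.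
rewrite ge0_integralZl//; last first.
  by move=> x _; rewrite mule_ge0 ?inv_powR_ge0// lee_fin.
apply: (@le_trans _ _ (K'%:E * ((C1 * r `^ (1 - g))%:E * inv_powR g (c s)))%E).
  rewrite lee_wpmul2l ?lee_fin// (le_trans (C1P _ _ _ rho0 r0))//.
  by rewrite lee_wpmul2l ?inv_powR_le// lee_fin mulr_ge0 ?powR_ge0// ltW.
rewrite muleA -EFinM le_eqVlt; apply/orP; left; apply/eqP.
by congr (_%:E * _)%E; rewrite /K'; ring.
Qed.

End slab.

(** * Determinants with some vertices replaced by directions *)

Section exchange_determinants.
Context {R : realType} {d : nat}.
Variable a : 'I_d.+1 -> euclid R d.

(** The state of the [j]-th factor when the vertices still present are the
    entries of [s]: row [j] is the fixed point [a j], the rows below [size s]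
    are vertices, and every other row is a direction vector at infinity.  The
    [d] rows other than [j] get the [d] different directions, through the
    bijection [unlift j]. *)
Definition partial_mx (j : 'I_d.+1) (s : seq (euclid R d)) : 'M[R]_d.+1 :=
  \matrix_(k, i)
    if unlift j k is Some u then
      if (k < size s)%N then homog (nth (a j) s k) i else (i == lift ord0 u)%:R
    else homog (a j) i.

Definition partial_det j s : R := \det (partial_mx j s).

(** The first column has a single nonzero entry, in row [j], and removing that
    row and column leaves the identity matrix. *)
Lemma partial_det_nil j : `|partial_det j [::]| = 1.
Proof.
rewrite /partial_det (expand_det_col _ ord0) (bigD1 j)//= big1 => [|k kj].
  rewrite addr0 mxE unlift_none homog0 mul1r /cofactor.
  rewrite (_ : row' _ _ = 1%:M) ?det1 ?mulr1 ?normrX ?normrN1 ?expr1n//.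
  apply/matrixP => k i; rewrite !mxE liftK/= eq_sym.
  by rewrite (inj_eq (@lift_inj _ _)).
rewrite mxE; case: unliftP kj => [u ->|->]; last by rewrite eqxx.
by rewrite /= mul0r.
Qed.

Lemma partial_mx_rcons j s x (k : 'I_d.+1) : size s = k -> forall k' i, k' != k ->
  partial_mx j (rcons s x) k' i = partial_mx j s k' i.
Proof.
move=> sk k' i k'k; rewrite !mxE; case: unlift => // u.
rewrite size_rcons ltnS leq_eqVlt sk val_eqE (negbTE k'k)/=.
by case: ifPn => // k'k'; rewrite nth_rcons sk k'k'.
Qed.

Lemma partial_det_skip (j : 'I_d.+1) s x : size s = j ->
  partial_det j (rcons s x) = partial_det j s.
Proof.
move=> sj; congr (\det _); apply/matrixP => k i.
have [->|kj] := eqVneq k j; first by rewrite !mxE unlift_none.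
by apply: (@partial_mx_rcons _ _ _ j).
Qed.

(** The Laplace expansion along row [k]: its cofactors are the coefficients of
    the affine function, and the determinant in which row [k] is a direction
    vector is one of them. *)
Lemma partial_det_affine (j k : 'I_d.+1) s : size s = k -> k != j ->
  exists (c : 'I_d -> R) (b : R) u,
    c u = partial_det j s /\
    forall x, partial_det j (rcons s x) = \sum_i c i * coord x i + b.
Proof.
move=> sk kj; pose cf i := cofactor (partial_mx j s) k i.
have cfE x i : cofactor (partial_mx j (rcons s x)) k i = cf i.
  rewrite /cf /cofactor; congr (_ * \det _); apply/matrixP => k' i'.
  by rewrite [LHS]mxE [RHS]mxE [LHS]mxE [RHS]mxE; apply: (partial_mx_rcons _ _ sk);
    rewrite eq_sym neq_lift.
have [u ju] : exists u, unlift j k = Some u.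
  by case: unliftP kj => [u _|->]; [exists u|rewrite eqxx].
exists (fun i => cf (lift ord0 i)), (cf ord0), u; split.
  rewrite /partial_det (expand_det_row _ k) (bigD1 (lift ord0 u))//= big1 => [|i iu].
    by rewrite mxE ju sk ltnn eqxx mul1r addr0.
  by rewrite mxE ju sk ltnn (negbTE iu) mul0r.
move=> x; rewrite /partial_det (expand_det_row _ k) big_ord_recl addrC.
have E i : partial_mx j (rcons s x) k i = homog x i.
  by rewrite mxE ju size_rcons sk ltnSn nth_rcons sk ltnn eqxx.
rewrite E cfE homog0 mul1r; congr (_ + _); apply: eq_bigr => i _.
by rewrite E cfE homogS mulrC.
Qed.

Lemma partial_det_full j (X : d.+1.-tuple (euclid R d)) :
  partial_det j X = \det (\matrix_(k, i) homog (if k == j then a j else tnth X k) i).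
Proof.
congr (\det _); apply/matrixP => k i; rewrite !mxE size_tuple ltn_ord.
case: unliftP => [u kE|->]; last by rewrite eqxx.
by rewrite (tnth_nth (a j)) kE eq_sym (negbTE (neq_lift _ _)).
Qed.

Lemma measurable_det dT (T : measurableType dT) n (M : T -> 'M[R]_n) :
  (forall i j, measurable_fun setT (fun t => M t i j : measurableTypeR R)) ->
  measurable_fun setT (fun t => \det (M t) : measurableTypeR R).
Proof.
move=> mM; apply: measurable_sum => s; apply: measurable_funM => //.
by apply: measurable_prod => i _; exact: mM.
Qed.

Lemma measurable_homog dT (T : measurableType dT) (f : T -> euclid R d) i :
  measurable_fun setT f ->
  measurable_fun setT (fun t => homog (f t) i : measurableTypeR R).
Proof.
move=> mf; rewrite /homog; case: unlift => [k|]; last exact: measurable_cst.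
exact: (measurableT_comp (measurable_coord k)).
Qed.

Lemma measurable_partial_det dT (T : measurableType dT) j (l : nat)
    (f : T -> seq (euclid R d)) :
  (forall t, size (f t) = l) ->
  (forall k, (k < l)%N -> measurable_fun setT (fun t => nth (a j) (f t) k)) ->
  measurable_fun setT (fun t => partial_det j (f t) : measurableTypeR R).
Proof.
move=> fl mf; apply: measurable_det => k i; under eq_fun do rewrite mxE fl.
case: unlift => [u|]; last exact: measurable_cst.
by case kl: (k < l)%N; [apply: measurable_homog; exact: mf|exact: measurable_cst].
Qed.

Lemma measurable_partial_det_cat j n (s : seq (euclid R d)) :
  measurable_fun setT
    (fun t : n.-tuple (euclid R d) => partial_det j (s ++ t) : measurableTypeR R).
Proof.
apply: (@measurable_partial_det _ _ _ (size s + n)%N) => [t|k kl].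
  by rewrite size_cat size_tuple.
under eq_fun do rewrite nth_cat.
case: ltnP => ks; first exact: measurable_cst.
have kn : (k - size s < n)%N by rewrite ltn_subLR.
under eq_fun => t do rewrite -(tnth_nth (a j) t (Ordinal kn)).
exact: measurable_tnth.
Qed.

Lemma measurable_partial_det_rcons j (s : seq (euclid R d)) :
  measurable_fun setT
    (fun x : euclid R d => partial_det j (rcons s x) : measurableTypeR R).
Proof.
apply: (@measurable_partial_det _ _ _ (size s).+1) => [x|k kl].
  by rewrite size_rcons.
under eq_fun do rewrite nth_rcons.
case: ltnP => ks; first exact: measurable_cst.
by case: eqP => _; [exact: measurable_id|exact: measurable_cst].
Qed.

End exchange_determinants.

(** * Integrating out the vertices *)

Section iterated_integral.
Context {R : realType}.

Local Notation leb n := (power_measure (@lebesgue_measure R) (n := n)).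

(** The product is at least the power of its smallest factor.  This crude form
    of the inequality of Hoelder reduces products of singular factors to a single
    one. *)
Lemma inv_powR_prod_le (I : finType) (P : pred I) (i0 : I) (u : I -> R) (s : R) :
  0 <= s -> P i0 ->
  (inv_powR s (\prod_(i | P i) u i) <=
   \sum_(i | P i) inv_powR (s * #|P|%:R) (u i))%E.
Proof.
move=> s0 Pi0; have := @arg_minP _ _ _ i0 P (fun i => `|u i|) Pi0.
set i := [arg min_(_ < _ | _) _]%O; case=> {i}i Pi imin.
rewrite [leRHS](bigD1 i)//=.
apply: (@le_trans _ _ (inv_powR (s * #|P|%:R) (u i))); last first.
  by rewrite leeDl// sume_ge0// => j _; exact: inv_powR_ge0.
have n0 : (#|P| != 0)%N by rewrite -lt0n; apply/card_gt0P; exists i.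
apply: (@le_trans _ _ (inv_powR s (u i ^+ #|P|))).
  apply: inv_powR_le => //; rewrite normrX normr_prod -prodr_const.
  by rewrite ler_prod// => j Pj; rewrite normr_ge0 imin.
have [->|ui0] := eqVneq (u i) 0.
  by rewrite expr0n (negbTE n0) /inv_powR eqxx.
rewrite !inv_powR_neq0 ?expf_neq0// lee_fin normrX -powR_mulrn// -powRrM.
by rewrite mulrN mulrC.
Qed.

(** If [s] has [k] entries, the factor [j = k] is not affected by the new
    vertex; the [d] other ones are affine in it, with one partial derivative
    equal to their value before the new vertex was added.  Dividing by these
    values and applying [inv_powR_prod_le] leads to [d] integrals of a single
    affine function to the power [- d / (d + 1)], with one partial derivative
    equal to [1]. *)
Lemma stage_integral m : exists2 C : R, 0 < C &
  forall (p : euclid R m.+3) (r w : R), 0 < w -> w <= r ->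
  forall (a : 'I_m.+4 -> euclid R m.+3) (s : seq (euclid R m.+3)),
  (size s < m.+4)%N ->
  (\int[leb m.+3]_x
     (inv_powR (m.+4%:R^-1) (\prod_j partial_det a j (rcons s x)) *
      (\1_(sphere_shell p r w) x)%:E) <=
   (C * (w * r ^+ m.+1 * r `^ (m.+4%:R^-1)))%:E *
   inv_powR (m.+4%:R^-1) (\prod_j partial_det a j s))%E.
Proof.
(* [m.+3] of the [m.+4] factors depend on the new vertex. *)
pose g : R := m.+4%:R^-1 * m.+3%:R.
have gE : 1 - g = m.+4%:R^-1.
  rewrite /g; have -> : m.+3%:R = m.+4%:R - 1 :> R by rewrite -(natr1 m.+3) addrK.
  by rewrite mulrBr mulVf ?pnatr_eq0// mulr1 opprB addrC subrK.
have g0 : 0 <= g by rewrite mulr_ge0.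
have g1 : g < 1 by rewrite -subr_gt0 gE invr_gt0 ltr0n.
have [C C0 CP] := @slab_integral R m g g0 g1.
exists (m.+3%:R * C); first by rewrite mulr_gt0.
move=> p r w w0 wr a s ss.
have r0 : 0 < r by exact: lt_le_trans wr.
pose th : R := m.+4%:R^-1; pose B := C * (w * r ^+ m.+1 * r `^ th).
have B0 : 0 < B by rewrite !mulr_gt0// ?exprn_gt0 ?powR_gt0.
rewrite -/th; set G := \prod_j partial_det a j s.
(* If one of the partial derivatives vanishes, the right-hand side is [+oo]. *)
have [G0|G0] := eqVneq G 0.
  rewrite G0 [X in (_ * X)%E]/inv_powR eqxx gt0_muley ?leey// lte_fin.
  by rewrite !mulr_gt0// ?exprn_gt0 ?powR_gt0.
have Gj j : partial_det a j s != 0 by move/prodf_neq0: G0; apply.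
pose k := Ordinal ss.
pose u x j := (partial_det a j s)^-1 * partial_det a j (rcons s x).
have mshell := measurable_sphere_shell p w0 wr.
have uP x : \prod_j partial_det a j (rcons s x) = \prod_i u x (lift k i) * G.
  rewrite /G (bigD1_ord k)//= [X in _ = _ * X](bigD1_ord k)//= partial_det_skip//.
  rewrite mulrCA; congr (_ * _); rewrite mulrC -big_split/=.
  by apply: eq_bigr => j _; rewrite /u mulrA mulfV// mul1r.
have uint i : (\int[leb m.+3]_x (inv_powR g (u x (lift k i)) *
      (\1_(sphere_shell p r w) x)%:E) <= B%:E)%E.
  set j := lift k i; have jk : k != j by rewrite neq_lift.
  have [c [b [l [cl cE]]]] := @partial_det_affine R _ a j k s erefl jk.
  pose c' i := (partial_det a j s)^-1 * c i.
  have c'l : c' l = 1 by rewrite /c' cl mulVf.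
  have := CP p r w w0 wr c' ((partial_det a j s)^-1 * b) l.
  rewrite c'l oner_eq0 => /(_ isT).
  rewrite inv_powR_neq0 ?oner_eq0// normr1 powR1 mule1 gE; apply: le_trans.
  rewrite le_eqVlt; apply/orP; left; apply/eqP; apply: eq_integral => x _.
  congr (inv_powR g _ * _)%E; rewrite /u cE mulrDr mulr_sumr; congr (_ + _).
  by apply: eq_bigr => h _; rewrite mulrA.
have mu_ j : measurable_fun setT (fun x : euclid R m.+3 => inv_powR g (u x j) *
      (\1_(sphere_shell p r w) x)%:E)%E.
  apply: emeasurable_funM; last exact/measurable_EFinP/measurable_indic.
  apply: (measurableT_comp (measurable_inv_powR g)).
  apply: measurable_funM => //; exact: measurable_partial_det_rcons.
have mF : measurable_fun setT (fun x : euclid R m.+3 =>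
   inv_powR th (\prod_j partial_det a j (rcons s x)) *
      (\1_(sphere_shell p r w) x)%:E)%E.
  apply: emeasurable_funM; last exact/measurable_EFinP/measurable_indic.
  apply: (measurableT_comp (measurable_inv_powR th)).
  by apply: measurable_prod => j _; exact: measurable_partial_det_rcons.
apply: (@le_trans _ _ (\int[leb m.+3]_x (inv_powR th G * \sum_i
    (inv_powR g (u x (lift k i)) * (\1_(sphere_shell p r w) x)%:E)))%E).
  apply: ge0_le_integral => //.
  - by move=> x _; rewrite mule_ge0 ?inv_powR_ge0// lee_fin.
  - by apply: measurable_funeM; apply: emeasurable_sum.
  move=> x _; rewrite uP (inv_powRM _ _ G0) muleAC muleC.
  rewrite lee_wpmul2l ?inv_powR_ge0// -ge0_sume_distrl.
    rewrite lee_wpmul2r ?lee_fin//.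
    have := @inv_powR_prod_le _ predT ord0 (fun i => u x (lift k i)) th.
    by rewrite card_ord -/g; apply => //; rewrite invr_ge0.
  by move=> j _; exact: inv_powR_ge0.
rewrite ge0_integralZl ?inv_powR_ge0//; last 2 first.
- exact: emeasurable_sum.
- by move=> x _; apply: sume_ge0 => j _; rewrite mule_ge0 ?inv_powR_ge0// lee_fin.
rewrite muleC lee_wpmul2r ?inv_powR_ge0// ge0_integral_sum//; last first.
  by move=> j x _; rewrite mule_ge0 ?inv_powR_ge0// lee_fin.
apply: (@le_trans _ _ (\sum_(i < m.+3) B%:E)%E).
  by apply: lee_sum => j _; exact: uint.
by rewrite sumEFin lee_fin sumr_const card_ord -[X in X <= _]mulr_natl /B !mulrA.
Qed.

(** The power measure integrates the first vertex last, so the induction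
    hypothesis is used for the list extended by the first vertex, and the
    stage of that vertex comes afterwards. *)
Lemma iterated_integral m : exists2 C : R, 0 < C &
  forall (p : euclid R m.+3) (r w : R), 0 < w -> w <= r ->
  forall (a : 'I_m.+4 -> euclid R m.+3) n (s : seq (euclid R m.+3)),
  (size s + n = m.+4)%N ->
  (\int[power_measure (leb m.+3) (n := n)]_t
     (inv_powR (m.+4%:R^-1) (\prod_j partial_det a j (s ++ t)) *
      (\1_[set t : n.-tuple (euclid R m.+3) |
           forall i, sphere_shell p r w (tnth t i)] t)%:E) <=
   ((C * (w * r ^+ m.+1 * r `^ (m.+4%:R^-1))) ^+ n)%:E *
   inv_powR (m.+4%:R^-1) (\prod_j partial_det a j s))%E.
Proof.
have [C C0 CP] := @stage_integral m; exists C => // p r w w0 wr a.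
have r0 : 0 < r by exact: lt_le_trans wr.
set th : R := m.+4%:R^-1; set B := C * _.
have B0 : 0 <= B by rewrite ltW// !mulr_gt0// ?exprn_gt0 ?powR_gt0.
have mshell := measurable_sphere_shell p w0 wr.
elim=> [|n IH] s sn.
  rewrite (eq_integral (cst (inv_powR th (\prod_j partial_det a j s)))); last first.
    move=> t _; rewrite [t]tuple0/= cats0 indicE mem_set ?mule1//.
    by case.
  by rewrite integral_cst//= diracE mem_set// mule1 expr0 mul1e.
have mF k (v : seq (euclid R m.+3)) : measurable_fun setT
  (fun t : k.-tuple (euclid R m.+3) =>
    inv_powR th (\prod_j partial_det a j (v ++ t)) *
      (\1_[set t : k.-tuple (euclid R m.+3) |
           forall i, sphere_shell p r w (tnth t i)] t)%:E)%E.
  apply: emeasurable_funM; last first.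
    apply/measurable_EFinP/measurable_indic.
    exact: (@measurable_box _ _ _ (fun=> sphere_shell p r w)).
  apply: (measurableT_comp (measurable_inv_powR th)).
  by apply: measurable_prod => j _; exact: measurable_partial_det_cat.
have F0 k (v : seq (euclid R m.+3)) (t : k.-tuple (euclid R m.+3)) : (0 <=
    inv_powR th (\prod_j partial_det a j (v ++ t)) *
      (\1_[set t : k.-tuple (euclid R m.+3) |
           forall i, sphere_shell p r w (tnth t i)] t)%:E)%E.
  by rewrite mule_ge0 ?inv_powR_ge0// lee_fin.
rewrite ge0_integral_power_measureS//.
have mH : measurable_fun setT (fun x : euclid R m.+3 =>
   inv_powR th (\prod_j partial_det a j (rcons s x)) *
      (\1_(sphere_shell p r w) x)%:E)%E.
  apply: emeasurable_funM; last exact/measurable_EFinP/measurable_indic.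
  apply: (measurableT_comp (measurable_inv_powR th)).
  by apply: measurable_prod => j _; exact: measurable_partial_det_rcons.
apply: (@le_trans _ _ (\int[leb m.+3]_x ((B ^+ n)%:E * (inv_powR th
   (\prod_j partial_det a j (rcons s x)) * (\1_(sphere_shell p r w) x)%:E)))%E).
  apply: ge0_le_integral => //.
  - by move=> x _; apply: integral_ge0 => t _; exact: F0.
  - exact: (measurable_fun_integral_cons _ (mF _ _) (F0 _ _)).
  - exact: measurable_funeM.
  move=> x _.
  rewrite (eq_integral (fun t : n.-tuple (euclid R m.+3) =>
      (\1_(sphere_shell p r w) x)%:E *
      (inv_powR th (\prod_j partial_det a j (rcons s x ++ t)) *
      (\1_[set t : n.-tuple (euclid R m.+3) |
           forall i, sphere_shell p r w (tnth t i)] t)%:E))%E); last first.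
    move=> t _; rewrite muleCA.
    under [in RHS]eq_bigr do rewrite cat_rcons.
    congr (inv_powR th _ * _)%E.
    rewrite -EFinM !indicE -natrM mulnb; congr ((nat_of_bool _)%:R)%:E.
    apply/idP/andP; rewrite !inE /=.
      move=> H; split; first by have := H ord0; rewrite tnth0.
      by move=> i; have := H (lift ord0 i); rewrite tnthS.
    move=> [xS tS] i; case: (unliftP ord0 i) => [j|] ->; first by rewrite tnthS.
    by rewrite tnth0.
  rewrite ge0_integralZl//; last exact: mF.
  rewrite [leRHS]muleA [leRHS]muleC lee_wpmul2l ?lee_fin//.
  by apply: IH; rewrite size_rcons; lia.
rewrite ge0_integralZl//; last 2 first.
- by move=> x _; rewrite mule_ge0 ?inv_powR_ge0// lee_fin.
- by rewrite lee_fin exprn_ge0.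
rewrite exprSr EFinM -muleA lee_wpmul2l ?lee_fin ?exprn_ge0//.
by apply: CP; lia.
Qed.

End iterated_integral.

(** * Reciprocal simplexes *)

Section reciprocal_simplexes.
Context {R : realType} {d : nat}.
Implicit Types (X A : d.+1.-tuple (euclid R d)) (i j : 'I_d.+1).

Definition replace_vertex X j (y : euclid R d) : d.+1.-tuple (euclid R d) :=
  [tuple (if k == j then y else tnth X k) | k < d.+1].

Lemma simplex_mx_replace X j y : simplex_mx (replace_vertex X j y) =
  \matrix_(k, i) homog (if k == j then y else tnth X k) i.
Proof. by apply/matrixP => k i; rewrite !mxE tnth_mktuple. Qed.

(** This says that barycentric coordinates add up to [1].  By Cramer's rule
    the summands are the coordinates of [homog x *m adj M]; its product with [M]
    is [det M *: homog x], of which only the first coordinate is looked at,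
    where all the homogeneous vectors have a [1]. *)
Lemma sum_det_replace_vertex A (x : euclid R d) :
  \sum_i \det (simplex_mx (replace_vertex A i x)) = \det (simplex_mx A).
Proof.
pose M := simplex_mx A; pose hx := \row_i homog x i.
have E i : \det (simplex_mx (replace_vertex A i x)) = (hx *m \adj M) 0 i.
  rewrite (expand_det_row _ i) mxE; apply: eq_bigr => k _.
  rewrite simplex_mx_replace mxE eqxx !mxE; congr (_ * _).
  rewrite /cofactor; congr (_ * \det _); apply/matrixP => a b; rewrite !mxE.
  by rewrite eq_sym (negbTE (neq_lift _ _)).
have : (hx *m \adj M *m M) 0 ord0 = \det M.
  by rewrite -mulmxA mul_adj_mx mul_mx_scalar !mxE homog0 mulr1.
rewrite mxE => <-; apply: eq_bigr => i _.
by rewrite E [X in _ * X]mxE homog0 mulr1.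
Qed.

(** The exchange is the permutation that transposes the positions of the two
    vertices.  If one of the new simplexes is degenerate the left-hand side
    vanishes, so volumes are only compared with determinants for
    nondegenerate simplexes. *)
Lemma reciprocal_exchange X A i j : reciprocal X A ->
  `|\det (simplex_mx (replace_vertex X j (tnth A i)))| *
  `|\det (simplex_mx (replace_vertex A i (tnth X j)))| <=
  `|\det (simplex_mx X)| * `|\det (simplex_mx A)|.
Proof.
move=> [/affinely_independent_det X0 /affinely_independent_det A0 XA].
have [->|X'0] := eqVneq (\det (simplex_mx (replace_vertex X j (tnth A i)))) 0.
  by rewrite normr0 mul0r mulr_ge0.
have [->|A'0] := eqVneq (\det (simplex_mx (replace_vertex A i (tnth X j)))) 0.
  by rewrite normr0 mulr0 mulr_ge0.
have [k k0 volE] := @simplex_volume_det R d.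
rewrite -(@ler_pM2r _ (k * k)) ?mulr_gt0// !(mulrACA _ _ k) -!volE// XA.
pose s := tperm (lshift d.+1 j) (rshift d.+1 i).
have -> : replace_vertex X j (tnth A i) = first_half [tuple of X ++ A] s.
  apply: eq_from_tnth => l; rewrite !tnth_mktuple permE/=.
  have -> : (lshift d.+1 l == rshift d.+1 i) = false by rewrite eq_lrshift.
  rewrite (inj_eq (@lshift_inj _ _)); case: ifP => _.
    by rewrite tnth_rshift.
  by rewrite tnth_lshift.
have -> : replace_vertex A i (tnth X j) = last_half [tuple of X ++ A] s.
  apply: eq_from_tnth => l; rewrite !tnth_mktuple permE/=.
  have -> : (rshift d.+1 l == lshift d.+1 j) = false by rewrite eq_rlshift.
  rewrite (inj_eq (@rshift_inj _ _)); case: ifP => _.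
    by rewrite tnth_lshift.
  by rewrite tnth_rshift.
exact: (le_bigmax _ (fun s => simplex_volume (first_half [tuple of X ++ A] s) *
  simplex_volume (last_half [tuple of X ++ A] s))).
Qed.

(** One of the [d + 1] barycentric coordinates of [tnth X j] is at least
    [1 / (d + 1)]; exchanging with the corresponding vertex gives the bound. *)
Lemma reciprocal_replace_le X A j : reciprocal X A -> exists i,
  `|\det (simplex_mx (replace_vertex X j (tnth A i)))| <=
  d.+1%:R * `|\det (simplex_mx X)|.
Proof.
move=> XA; have [_ /affinely_independent_det A0 _] := XA.
have [i iP] : exists i, `|\det (simplex_mx A)| <=
    d.+1%:R * `|\det (simplex_mx (replace_vertex A i (tnth X j)))|.
  apply/existsP; rewrite -[X in is_true X]negbK negb_exists; apply/negP => /forallP H.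
  have : `|\det (simplex_mx A)| < `|\det (simplex_mx A)|.
    rewrite -{1}(sum_det_replace_vertex A (tnth X j)).
    apply: le_lt_trans (ler_norm_sum _ _ _) _.
    apply: (@lt_le_trans _ _ (\sum_(i < d.+1) d.+1%:R^-1 * `|\det (simplex_mx A)|)).
      apply: ltr_sum => [|i _].
        by apply/hasP; exists ord0; rewrite ?mem_index_enum.
      by rewrite ltr_pdivlMl ?ltr0n// ltNge.
    by rewrite sumr_const card_ord -[leLHS]mulr_natl mulrA mulfV ?mul1r// pnatr_eq0.
  by rewrite ltxx.
exists i; have h := reciprocal_exchange i j XA.
rewrite -(@ler_pM2r _ `|\det (simplex_mx A)|) ?normr_gt0//.
apply: (@le_trans _ _ (`|\det (simplex_mx (replace_vertex X j (tnth A i)))| *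
   (d.+1%:R * `|\det (simplex_mx (replace_vertex A i (tnth X j)))|))).
  by rewrite ler_wpM2l.
by rewrite mulrCA -mulrA ler_wpM2l.
Qed.

(** The choice of [i] for each [j] depends on [X]; summing over all the
    choices makes the bound a fixed measurable function of [X]. *)
Lemma reciprocal_volume_le : exists2 K : R, 0 < K &
  forall X A, reciprocal X A ->
  (((simplex_volume X)^-1)%:E <= K%:E *
   \sum_(f : {ffun 'I_d.+1 -> 'I_d.+1})
     inv_powR (d.+1%:R^-1) (\prod_j partial_det (fun j => tnth A (f j)) j X))%E.
Proof.
have [k k0 volE] := @simplex_volume_det R d.
exists (d.+1%:R / k); first by rewrite divr_gt0.
move=> X A XA; have [/affinely_independent_det X0 _ _] := XA.
have /fin_all_exists [f fP] := fun j => reciprocal_replace_le j XA.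
rewrite (bigD1 (finfun f))//=; set y := \prod_j _; set S := (\sum_(_ | _) _)%E.
have S0 : (0 <= S)%E by apply: sume_ge0 => h _; exact: inv_powR_ge0.
apply: (@le_trans _ _ ((d.+1%:R / k)%:E * inv_powR d.+1%:R^-1 y)%E); last first.
  by rewrite lee_wpmul2l ?leeDl// lee_fin divr_ge0// ltW.
pose D := d.+1%:R * `|\det (simplex_mx X)|.
have D0 : 0 < D by rewrite mulr_gt0 ?ltr0n// normr_gt0.
have yD : `|y| <= `|D ^+ d.+1|.
  rewrite normrX (gtr0_norm D0) /y normr_prod -[in leRHS](card_ord d.+1) -prodr_const.
  apply: ler_prod => j _.
  rewrite normr_ge0/= partial_det_full -simplex_mx_replace ffunE.
  exact: fP.
have DE : inv_powR d.+1%:R^-1 (D ^+ d.+1) = (D^-1)%:E.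
  rewrite inv_powR_neq0 ?expf_neq0 ?gt_eqF// normrX (gtr0_norm D0) -powR_mulrn ?ltW//.
  by rewrite -powRrM mulrN mulfV ?pnatr_eq0// powR_inv1// ltW.
apply: (@le_trans _ _ ((d.+1%:R / k)%:E * (D^-1)%:E)%E).
  rewrite volE// -EFinM lee_fin /D le_eqVlt; apply/orP; left; apply/eqP.
  have nX : `|\det (simplex_mx X)| != 0 by rewrite normr_eq0.
  have kn : k != 0 by rewrite gt_eqF.
  have dn : d.+1%:R != 0 :> R by rewrite pnatr_eq0.
  move: (d.+1%:R : R) dn => e en; field.
  by rewrite ?nX ?kn ?en.
by rewrite lee_wpmul2l ?lee_fin ?divr_ge0 ?(ltW k0)// -DE inv_powR_le// invr_ge0.
Qed.

End reciprocal_simplexes.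

Section integral_upper_bound.
Local Open Scope ereal_scope.
Context d (T : measurableType d) (R : realType).

(** No measurability is required of [D] or [f]: the integral of a
    nonnegative function is a supremum over the simple functions below it. *)
Lemma ge0_le_integral_setT (mu : {measure set T -> \bar R}) (D : set T)
    (f g : T -> \bar R) :
  (forall x, D x -> 0 <= f x <= g x) -> (forall x, 0 <= g x) ->
  \int[mu]_(x in D) f x <= \int[mu]_x g x.
Proof.
move=> fg g0; rewrite ge0_integralE => [|x /fg/andP[]//].
rewrite ge0_integralTE//; apply: le_ereal_sup => _ [h hf <-]; exists h => //.
move=> x /=; apply: (le_trans (hf x)); rewrite patchE; case: ifPn => //.
by rewrite inE => /fg/andP[].
Qed.

End integral_upper_bound.

Theorem theorem1p4 (R : realType) (d : nat) (hd : (3 <= d)%N) :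
  exists C : R, 0 < C /\
    forall (p : euclid R d) (r w : R), 0 < w -> w <= r ->
    forall A : d.+1.-tuple (euclid R d), affinely_independent A ->
      (\int[power_measure (power_measure (@lebesgue_measure R) (n := d))
              (n := d.+1)]_(X in
          [set X | reciprocal X A] `&`
          [set X | forall i, sphere_shell p r w (tnth X i)])
         ((simplex_volume X)^-1)%:E
       <= (C * w ^+ d.+1 * r ^+ (d ^ 2 - d - 1))%:E)%E.
Proof.
case: d hd => [|[|[|m]]]// _.
have [K K0 KP] := @reciprocal_volume_le R m.+3.
have [C C0 CP] := @iterated_integral R m.
pose N := #|{ffun 'I_m.+4 -> 'I_m.+4}|.
exists (K * (1 + N%:R) * C ^+ m.+4); split.
  have N0 : 0 < 1 + N%:R :> R by rewrite ltr_pwDl.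
  by apply: mulr_gt0; [exact: mulr_gt0|exact: exprn_gt0].
move=> p r w w0 wr A _.
have r0 : 0 < r by exact: lt_le_trans wr.
have mshell := measurable_sphere_shell p w0 wr.
pose Sh := [set X : m.+4.-tuple (euclid R m.+3) |
  forall i, sphere_shell p r w (tnth X i)].
have mSh : measurable Sh by exact: (@measurable_box _ _ _ (fun=> sphere_shell p r w)).
pose F (f : {ffun 'I_m.+4 -> 'I_m.+4}) (X : m.+4.-tuple (euclid R m.+3)) : \bar R :=
  (inv_powR (m.+4%:R^-1) (\prod_j partial_det (fun j => tnth A (f j)) j X) *
   (\1_Sh X)%:E)%E.
have F0 f X : (0 <= F f X)%E by rewrite mule_ge0 ?inv_powR_ge0// lee_fin.
have mF f : measurable_fun setT (F f).
  apply: emeasurable_funM; last exact/measurable_EFinP/measurable_indic.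
  apply: (measurableT_comp (measurable_inv_powR _)).
  apply: measurable_prod => j _.
  exact: (@measurable_partial_det_cat R m.+3 (fun j => tnth A (f j)) j m.+4 [::]).
have FP f : (\int[power_measure (power_measure (@lebesgue_measure R) (n := m.+3))
      (n := m.+4)]_X F f X <= ((C * (w * r ^+ m.+1 * r `^ (m.+4%:R^-1))) ^+ m.+4)%:E)%E.
  apply: le_trans (CP p r w w0 wr (fun j => tnth A (f j)) m.+4 [::] erefl) _.
  have n1 : `|\prod_j partial_det (fun j => tnth A (f j)) j [::]| = 1.
    by rewrite normr_prod big1// => j _; exact: partial_det_nil.
  by rewrite inv_powR_neq0 -?normr_gt0 n1// powR1 mule1.
apply: (@le_trans _ _ (\int[power_measure (power_measure (@lebesgue_measure R) (n := m.+3))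
      (n := m.+4)]_X (K%:E * \sum_f F f X))%E).
  apply: ge0_le_integral_setT => [X [XA XS]|X]; last first.
    by rewrite mule_ge0 ?lee_fin ?(ltW K0)// sume_ge0.
  apply/andP; split; first by rewrite lee_fin invr_ge0 fine_ge0.
  apply: (le_trans (KP X A XA)); rewrite lee_wpmul2l ?lee_fin ?(ltW K0)//.
  apply: lee_sum => f _; rewrite /F indicE mem_set//.
  by rewrite mule1.
rewrite ge0_integralZl//; last 3 first.
- exact: emeasurable_sum.
- by move=> X _; exact: sume_ge0.
- by rewrite lee_fin ltW.
rewrite ge0_integral_sum//.
apply: (@le_trans _ _ (K%:E * \sum_(f : {ffun 'I_m.+4 -> 'I_m.+4})
   ((C * (w * r ^+ m.+1 * r `^ (m.+4%:R^-1))) ^+ m.+4)%:E)%E).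
  by rewrite lee_wpmul2l ?lee_fin ?(ltW K0)//; apply: lee_sum => f _; exact: FP.
rewrite sumEFin sumr_const -/N -EFinM lee_fin.
(* Each of the [m.+4] stages contributes [r ^ m.+1] and an [m.+4]-th root of [r]. *)
have -> : (m.+3 ^ 2 - m.+3 - 1)%N = (m.+1 * m.+4 + 1)%N by lia.
rewrite exprD exprM !exprMn.
have -> : (r `^ m.+4%:R^-1) ^+ m.+4 = r.
  by rewrite -powR_mulrn ?powR_ge0// -powRrM mulVf ?pnatr_eq0// powRr1// ltW.
rewrite -exprM expr1 -[X in _ * X <= _]mulr_natl -/N.
set T := C ^+ _ * _; have T0 : 0 <= T.
  rewrite /T mulr_ge0 ?exprn_ge0 ?(ltW C0)//.
  apply: mulr_ge0; last exact: ltW.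
  by apply: mulr_ge0; rewrite exprn_ge0 ?(ltW w0) ?(ltW r0).
rewrite [leRHS](_ : _ = K * ((1 + N%:R) * T)); last by rewrite /T; ring.
by rewrite ler_wpM2l ?(ltW K0)// ler_wpM2r// lerDr.
Qed.
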